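(* Let $1\le p,q,r\le\infty$ with $\frac1p=\frac1q+\frac1r$. The class $\mathcal P^+_{w,(q,r)}$ of positive weakly $(q,r)$-dominated homogeneous polynomials between Banach lattices, equipped with $d^{m+}_{w,(q,r)}$ on the $m$-homogeneous polynomials for each $m\in\mathbb N^*$, is a positive Banach polynomial ideal.
   Context: All Banach lattices are real. $E^+$ is the positive cone of $E$; $\mathcal L^+(G;E)$ is the set of positive bounded linear operators. $\mathcal P(^mE;F)$ is the space of continuous $m$-homogeneous polynomials from $E$ to $F$. A polynomial is positive if its associated symmetric $m$-linear operator is positive (maps tuples of positive elements to positive elements), and regular if it is a difference of two positive ones. $\mathcal P^r(^mE)$ is the Banach lattice of regular scalar-valued $m$-homogeneous polynomials, with norm $\|\,|\phi|\,\|$ (supremum norm of the modulus), and $B^+_{\mathcal P^r(^mE)}$ is the set of its positive elements of norm at most $1$. For a finite sequence $(y_i)_{i=1}^n$ in a Banach lattice $G$, $\|(y_i)_{i=1}^n\|_{r,|w|}=\sup\{(\sum_{i=1}^n\langle \xi,|y_i|\rangle^r)^{1/r}:\xi\in B_{G^*},\ \xi\ge0\}$. $\|\cdot\|_p$ is the $\ell_p^n$ norm. Power sums with exponent $\infty$ are replaced by maxima. Definition (the class). $P\in\mathcal P(^mE;F)$ is positive weakly $(q,r)$-dominated if there is $C>0$ such that for all $n$, all $(x_i)_{i=1}^n\subset E^+$ and all $(y_i^* )_{i=1}^n\subset F^{*+}$, $$\big\|(\langle P(x_i),y_i^*\rangle)_{i=1}^n\big\|_p\le C\sup_{\phi\in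 B^+_{\mathcal P^r(^mE)}}\Big(\sum_{i=1}^n\phi(x_i)^q\Big)^{1/q}\|(y_i^* )_{i=1}^n\|_{r,|w|}.$$ The space of all such $P$ is $\mathcal P^{+}_{w,(q,r)}(^mE;F)$, and $d^{m+}_{w,(q,r)}(P)$ is the infimum of all such constants $C$. Definition (positive Banach polynomial ideal). A class $\mathcal P^+$ of continuous homogeneous polynomials between Banach lattices, with $\|\cdot\|_{\mathcal P^+}:\mathcal P^+\to[0,\infty)$, is a positive Banach polynomial ideal if for all $m\in\mathbb N^*$ and all Banach lattices $E,F$, with $\mathcal P^+(^mE;F)=\mathcal P(^mE;F)\cap\mathcal P^+$: (i) $\mathcal P^+(^mE;F)$ is a linear subspace of $\mathcal P(^mE;F)$ containing the finite type polynomials $x\mapsto\sum_{i=1}^k\varphi_i(x)^m y_i$ ($\varphi_i\in E^*$, $y_i\in F$). (ii) If $P\in\mathcal P^+(^mE;F)$, $u\in\mathcal L^+(G;E)$ and $v\in\mathcal L^+(F;H)$, then $v\circ P\circ u\in\mathcal P^+(^mG;H)$. (a) $(\mathcal P^+(^mE;F),\|\cdot\|_{\mathcal P^+})$ is a Banach space. (b) The polynomial $\mathbb R\to\mathbb R$, $\lambda\mapsto\lambda^m$, has $\|\cdot\|_{\mathcal P^+}$-norm $1$ for all $m$. (c) In the situation of (ii), $\|v\circ P\circ u\|_{\mathcal P^+}\le\|v\|\,\|P\|_{\mathcal P^+}\,\|u\|^m$. *)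

(* Defs.v *)
From HB Require Import structures.
From mathcomp Require Import all_boot all_order all_algebra.
From mathcomp Require Import all_classical all_reals.
From mathcomp Require Import ereal topology normedtype exp.
From mathcomp Require Import perm lra.
Set Implicit Arguments.
Unset Strict Implicit.
Unset Printing Implicit Defensive.
Import Order.TTheory GRing.Theory Num.Theory numFieldNormedType.Exports.
Local Open Scope classical_set_scope.
Local Open Scope ring_scope.

(* Only joins are required: the translation-invariance [vleD2r] makes
   [- vjoin (- x) (- y)] a meet of [x] and [y].  The modulus of [x] is
   [vjoin x (- x)], see [vabs] below. *)
HB.mixin Record isBanachLattice (R : realType) E of CompleteNormedModule R E := {
  vle : E -> E -> Prop ;
  vjoin : E -> E -> E ;
  vle_refl : forall x, vle x x ;
  vle_anti : forall x y, vle x y -> vle y x -> x = y ;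
  vle_trans : forall y x z, vle x y -> vle y z -> vle x z ;
  vjoinP : forall x y z, vle (vjoin x y) z <-> vle x z /\ vle y z ;
  vleD2r : forall z x y, vle x y -> vle (x + z) (y + z) ;
  vscale_ge0 : forall (a : R) x, 0 <= a -> vle 0 x -> vle 0 (a *: x) ;
  vnorm_le : forall x y, vle (vjoin x (- x)) (vjoin y (- y)) -> `|x| <= `|y|
}.

#[short(type="banachLatticeType")]
HB.structure Definition BanachLattice (R : realType) :=
  {E of CompleteNormedModule R E & isBanachLattice R E}.

Arguments vleD2r {R s} z [x y].
Arguments vle_trans {R s} [y x z].
Arguments vscale_ge0 {R s} [a x].
Arguments vnorm_le {R s} [x y].

Notation "x <=v y" := (vle x y) (at level 70, no associativity) : ring_scope.

Definition vabs (R : realType) (E : banachLatticeType R) (x : E) : E :=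
  vjoin x (- x).

Section RieszSpaces.
Context {R : realType} {E : banachLatticeType R}.
Implicit Types (x y z : E) (a : R).

Lemma vjoin_l x y : x <=v vjoin x y.
Proof. by case: (proj1 (vjoinP x y _) (vle_refl _)). Qed.

Lemma vjoin_r x y : y <=v vjoin x y.
Proof. by case: (proj1 (vjoinP x y _) (vle_refl _)). Qed.

Lemma vjoin_le x y z : x <=v z -> y <=v z -> vjoin x y <=v z.
Proof. by move=> xz yz; apply/vjoinP. Qed.

Lemma vsubr_ge0 x y : 0 <=v y - x <-> x <=v y.
Proof.
split=> [/(vleD2r x)|/(vleD2r (- x))]; first by rewrite add0r subrK.
by rewrite subrr.
Qed.

Lemma vaddr_ge0 x y : 0 <=v x -> 0 <=v y -> 0 <=v x + y.
Proof.
move=> x0 y0; apply: vle_trans y0 _.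
by have := vleD2r y x0; rewrite add0r.
Qed.

Lemma vleD x y z t : x <=v y -> z <=v t -> x + z <=v y + t.
Proof.
move=> /vsubr_ge0 xy /vsubr_ge0 zt; apply/vsubr_ge0.
by rewrite opprD addrACA; exact: vaddr_ge0.
Qed.

Lemma vleN x y : x <=v y -> - y <=v - x.
Proof. by move=> /vsubr_ge0 xy; apply/vsubr_ge0; rewrite opprK addrC. Qed.

Lemma vabs_ge0 x : 0 <=v vabs x.
Proof.
have h : 0 <=v vabs x + vabs x.
  by rewrite -(subrr x); apply: vleD; [exact: vjoin_l|exact: vjoin_r].
have -> : vabs x = (2^-1 : R) *: (vabs x + vabs x).
  by rewrite scalerDr -scalerDl -[LHS]scale1r; congr (_ *: _); lra.
by apply: vscale_ge0 => //; rewrite invr_ge0.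
Qed.

Lemma vabs_pos x : 0 <=v x -> vabs x = x.
Proof.
move=> x0; apply: vle_anti; last exact: vjoin_l.
apply: vjoin_le; first exact: vle_refl.
by apply: vle_trans (x0); rewrite -oppr0; exact: vleN.
Qed.

Lemma vnorm_interval x z : - z <=v x -> x <=v z -> `|x| <= `|z|.
Proof.
move=> zx xz; apply: vnorm_le; apply: vle_trans (vjoin_l _ _).
by apply: vjoin_le => //; rewrite -(opprK z); exact: vleN.
Qed.

Lemma vnorm_pos x z : 0 <=v x -> x <=v z -> `|x| <= `|z|.
Proof.
move=> x0 xz; apply: vnorm_interval => //; apply: vle_trans (x0).
by rewrite -oppr0; apply: vleN; exact: vle_trans x0 xz.
Qed.

Lemma vnorm_vabs x : `|vabs x| = `|x|.
Proof.
have e : vabs (vabs x) = vabs x by rewrite vabs_pos//; exact: vabs_ge0.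
by apply/eqP; rewrite eq_le; apply/andP; split; apply: vnorm_le;
  rewrite -/(vabs _) -/(vabs _) e; exact: vle_refl.
Qed.

Definition vpos x := vjoin x 0.

Lemma vpos_ge0 x : 0 <=v vpos x. Proof. exact: vjoin_r. Qed.

Lemma vposB x : x = vpos x - vpos (- x).
Proof.
have e y : vpos y - y <=v vpos (- y).
  apply/vsubr_ge0; rewrite opprB addrA.
  have /vsubr_ge0 h : vpos y <=v vpos (- y) + y.
    apply: vjoin_le; first by have := vleD2r y (vpos_ge0 (- y)); rewrite add0r.
    by have := vleD2r y (vjoin_l (- y) 0); rewrite addNr.
  exact: h.
have e1 := e x; have := e (- x); rewrite opprK => e2.
apply: (@addIr _ (vpos (- x))); rewrite subrK; apply: vle_anti.
  by have := vleD2r 0 e2; rewrite !addr0 addrC.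
by have := vleD2r x e1; rewrite subrK addrC.
Qed.

Lemma vpos_norm x : `|vpos x| <= `|x|.
Proof.
rewrite -(vnorm_vabs x); apply: vnorm_pos; first exact: vpos_ge0.
by apply: vjoin_le; [exact: vjoin_l|exact: vabs_ge0].
Qed.

Lemma riesz_decomposition x y z : 0 <=v x -> 0 <=v y -> 0 <=v z -> z <=v x + y ->
  exists z1 z2, [/\ z = z1 + z2, 0 <=v z1 /\ z1 <=v x & 0 <=v z2 /\ z2 <=v y].
Proof.
move=> x0 y0 z0 zxy; exists (z - vpos (z - x)), (vpos (z - x)); split.
- by rewrite subrK.
- split.
  + apply/vsubr_ge0; apply: vjoin_le => //; apply/vsubr_ge0.
    by rewrite opprB addrC subrK.
  + have /vsubr_ge0 := vjoin_l (z - x) 0 => h; apply/vsubr_ge0.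
    by rewrite opprB addrCA in h; rewrite opprB.
- split; first exact: vpos_ge0.
  apply: vjoin_le => //; apply/vsubr_ge0; move/vsubr_ge0: zxy.
  by rewrite opprB addrA (addrC y).
Qed.

End RieszSpaces.

Section RealBanachLattice.
Context {R : realType}.

Let real_joinP (x y z : R) : (Num.max x y <= z) <-> (x <= z) /\ (y <= z).
Proof. by rewrite ge_max; split=> [/andP[]|[-> ->]]. Qed.

Let real_norm_le (x y : R) : Num.max x (- x) <= Num.max y (- y) -> `|x| <= `|y|.
Proof. by rewrite !maxrN. Qed.

HB.instance Definition _ := isBanachLattice.Build R R
  (@lexx _ R) (fun (x y : R) xy yx => le_anti (introT andP (conj xy yx)))
  (fun y x z : R => @le_trans _ R y x z) real_joinP
  (fun z x y xy => etrans (lerD2r z x y) xy) (@mulr_ge0 R)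
  real_norm_le.

End RealBanachLattice.

(* [sup] is the real supremum; the set below is bounded above for the
   continuous linear operators and continuous homogeneous polynomials to which
   [supnorm] is applied. *)
Definition supnorm (R : realType) (E F : normedModType R) (f : E -> F) : R :=
  sup [set `|f x| | x in [set x | `|x| <= 1]].

Section DualSpace.
Context {R : realType} (E : normedModType R).

Definition linear_functional : {pred E -> R} :=
  fun f => `[< linear f /\ continuous f >].

Lemma linear_functional_submod : submod_closed linear_functional.
Proof.
split=> [|a f g /asboolP[lf cf] /asboolP[lg cg]]; apply/asboolP; split.
- by move=> a x y; rewrite /= scaler0 addr0.
- by move=> x; exact: cvg_cst.
- move=> b x y /=; rewrite !fctE lf lg !scalerDr !scalerA (mulrC a) -!addrA.
  by congr (_ + _); rewrite addrCA.
- by move=> x; apply: cvgD; [apply: cvgZr; exact: cf|exact: cg].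
Qed.

HB.instance Definition _ := GRing.isSubmodClosed.Build R (E -> R)
  linear_functional linear_functional_submod.

Record dual := Dual {
  dual_fun :> E -> R ;
  _ : dual_fun \in linear_functional }.

HB.instance Definition _ := [isSub for dual_fun].
HB.instance Definition _ := [Choice of dual by <:].
HB.instance Definition _ := [SubChoice_isSubLmodule of dual by <:].

Implicit Types f g : dual.

Lemma dual_linear f : linear f. Proof. by case: f => f /= /asboolP[]. Qed.

Lemma dual_continuous f : continuous f.
Proof. by case: f => f /= /asboolP[]. Qed.

HB.instance Definition _ f :=
  GRing.isLinear.Build R E R *:%R f (dual_linear f).

Lemma dualP f g : (forall x, f x = g x) -> f = g.
Proof. by move=> fg; apply: val_inj; apply/funext. Qed.

Lemma dual_bounded f : exists2 M, 0 < M & forall x, `|f x| <= M * `|x|.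
Proof.
have /linear_bounded_continuous/linear_boundedP := @dual_continuous f.
move=> [M [_ h]]; exists (`|M| + 1); first by rewrite ltr_wpDl.
by move=> x; apply: h; rewrite (le_lt_trans (ler_norm M))// ltrDl.
Qed.

Lemma dual_bounded_continuous (f : E -> R) M : linear f ->
  (forall x, `|f x| <= M * `|x|) -> f \in linear_functional.
Proof.
move=> lf fM; apply/asboolP; split=> //.
pose fL := GRing.isLinear.Build R E R *:%R f lf.
pose L : {linear E -> R} := HB.pack f fL.
have := @linear_bounded_continuous _ _ _ L; case=> + _; apply.
apply/linear_boundedP; exists M; split; first exact: num_real.
move=> r Mr x; apply: le_trans (fM x) _.
by rewrite ler_wpM2r// ltW.
Qed.

Lemma supnorm_ub f : has_ubound [set `|f x| | x in [set x | `|x| <= 1]].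
Proof.
have [M M0 fM] := dual_bounded f; exists M => _ [x /= x1 <-].
by apply: le_trans (fM x) _; rewrite -[leRHS]mulr1 ler_wpM2l// ltW.
Qed.

Lemma supnorm_ball f x : `|x| <= 1 -> `|f x| <= supnorm f.
Proof. by move=> x1; apply: ub_le_sup (supnorm_ub f) _ _; exists x. Qed.

Lemma supnorm_ge0 f : 0 <= supnorm f.
Proof. by apply: le_trans (supnorm_ball f (x := 0) _); rewrite ?normr0. Qed.

Lemma supnorm_le_ball f M : (forall x, `|x| <= 1 -> `|f x| <= M) ->
  supnorm f <= M.
Proof.
move=> fM; apply: ge_sup; first by exists `|f 0|, 0; rewrite /= ?normr0.
by move=> _ [x /= x1 <-]; exact: fM.
Qed.

Lemma supnorm_le f x : `|f x| <= supnorm f * `|x|.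
Proof.
have [->|x0] := eqVneq x 0; first by rewrite linear0 !normr0 mulr0.
have nx : 0 < `|x| by rewrite normr_gt0.
rewrite -ler_pdivrMr// mulrC -{1}(gtr0_norm nx) -normfV -normrM.
rewrite -[_ * f x]/(`|x|^-1 *: f x) -linearZ; apply: supnorm_ball.
by rewrite normrZ normfV normr_id mulVf// gt_eqF.
Qed.

Lemma supnormD f g : supnorm (f + g : dual) <= supnorm f + supnorm g.
Proof.
apply: supnorm_le_ball => x x1.
by apply: le_trans (ler_normD _ _) _; apply: lerD; exact: supnorm_ball.
Qed.

Lemma supnormZ_le a f : supnorm (a *: f : dual) <= `|a| * supnorm f.
Proof.
apply: supnorm_le_ball => x x1; rewrite /= normrM.
by apply: ler_wpM2l => //; exact: supnorm_ball.
Qed.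

Lemma supnormZ a f : supnorm (a *: f : dual) = `|a| * supnorm f.
Proof.
apply/eqP; rewrite eq_le supnormZ_le/=; have [->|a0] := eqVneq a 0.
  by rewrite normr0 mul0r; exact: (supnorm_ge0 (0 *: f)).
have := supnormZ_le a^-1 (a *: f); rewrite scalerA mulVf// scale1r.
by rewrite normfV mulrC ler_pdivlMr ?normr_gt0// mulrC.
Qed.

Lemma supnorm_eq0 f : supnorm f = 0 -> f = 0.
Proof.
move=> f0; apply: dualP => x; apply/eqP; rewrite -normr_le0.
by apply: le_trans (supnorm_le f x) _; rewrite f0 mul0r.
Qed.

HB.instance Definition _ := Lmodule_isNormed.Build R dual
  supnormD supnormZ supnorm_eq0.

Lemma dual_normE f : `|f| = supnorm f. Proof. by []. Qed.

Lemma dual_norm_le f x : `|f x| <= `|f| * `|x|.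
Proof. exact: supnorm_le. Qed.

Lemma dual_complete (F : set_system dual) :
  ProperFilter F -> cauchy F -> cvg F.
Proof.
move=> FF /cauchy_ballP Fc.
have Fc' e : 0 < e -> exists f0, \forall f \near F, `|f0 - f| < e.
  move=> e0; have /cauchy_ballP/cauchyP/(_ _ e0)[f0 f0e] := Fc.
  by exists f0; move: f0e; rewrite -ball_normE.
have cvx (x : E) : cvg ((fun f : dual => f x : R) @ F).
  apply/cauchy_cvgP/cauchy_exP => e e0.
  have d0 : 0 < e / (`|x| + 1) by rewrite divr_gt0// ltr_wpDl.
  have [f0 f0e] := Fc' _ d0; exists (f0 x).
  apply: filterS f0e => f f0f; rewrite /= -ball_normE /ball_/=.
  apply: le_lt_trans (dual_norm_le (f0 - f) x) _.
  apply: (@le_lt_trans _ _ (`|f0 - f| * (`|x| + 1))).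
    by rewrite ler_wpM2l// lerDl.
  by rewrite -ltr_pdivlMr// ltr_wpDl.
pose l x := lim ((fun f : dual => f x : R) @ F).
have ll : linear l.
  move=> a x y; apply/cvg_lim => //.
  have -> : (fun f : dual => f (a *: x + y) : R) =
            (fun f : dual => (a *: f x + f y : R)).
    by apply/funext => f; rewrite linearP.
  by apply: cvgD; [apply: cvgZr; exact: cvx|exact: cvx].
have lle f0 e : (\forall f \near F, `|f0 - f| < e) ->
    forall x, `|f0 x - l x| <= e * `|x|.
  move=> f0e x.
  have : (fun f : dual => `|f0 x - f x| : R) @ F --> `|f0 x - l x|.
    by apply: cvg_norm; apply: cvgB; [exact: cvg_cst|exact: cvx].
  move=> /cvgr_to_le; apply.
  apply: filterS f0e => f /ltW f0f.
  by apply: le_trans (dual_norm_le (f0 - f) x) _; rewrite ler_wpM2r.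
have [f1 f1e] := Fc' _ ltr01.
have lM x : `|l x| <= (`|f1| + 1) * `|x|.
  have -> : l x = f1 x - (f1 x - l x) by rewrite subKr.
  apply: le_trans (ler_normB _ _) _; rewrite mulrDl.
  by apply: lerD; [exact: dual_norm_le|exact: lle].
apply/cvg_ex; exists (Dual (dual_bounded_continuous ll lM)).
apply/fcvgrPdist_lt => e e0; have e20 : 0 < e / 4 by rewrite divr_gt0.
have [f0 f0e] := Fc' _ e20.
apply: filterS (f0e) => f f0f.
apply: (@le_lt_trans _ _ (e / 2)); last by lra.
apply: supnorm_le_ball => x x1.
rewrite -[leLHS]/(`|l x - f x|).
have -> : l x - f x = (f0 x - f x) - (f0 x - l x) by lra.
apply: le_trans (ler_normB _ _) _.
have -> : e / 2 = e / 4 + e / 4 by lra.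
apply: lerD.
  apply: le_trans (dual_norm_le (f0 - f) x) _; rewrite -[leRHS]mulr1.
  by apply: ler_pM => //; exact: ltW.
apply: le_trans (lle _ _ f0e x) _; rewrite -[leRHS]mulr1.
by apply: ler_wpM2l => //; exact: ltW.
Qed.

HB.instance Definition _ := Uniform_isComplete.Build dual dual_complete.

End DualSpace.

Section DualLattice.
Context {R : realType} (E : banachLatticeType R).
Implicit Types (f g h : dual E) (x y z : E).

Definition dual_le f g : Prop := forall x, 0 <=v x -> f x <= g x.

Lemma dual_le_refl f : dual_le f f. Proof. by move=> x _. Qed.

Lemma dual_le_anti f g : dual_le f g -> dual_le g f -> f = g.
Proof.
move=> fg gf; apply: dualP => x.
have e y : 0 <=v y -> f y = g y.
  by move=> y0; apply/eqP; rewrite eq_le fg ?gf.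
by rewrite (vposB x) !linearB /= !e//; exact: vpos_ge0.
Qed.

Lemma dual_le_trans g f h : dual_le f g -> dual_le g h -> dual_le f h.
Proof. by move=> fg gh x x0; apply: le_trans (fg _ x0) (gh _ x0). Qed.

Lemma dual_leD2r h f g : dual_le f g -> dual_le (f + h) (g + h).
Proof. by move=> fg x x0; rewrite lerD2r; exact: fg. Qed.

Lemma dual_scale_ge0 (a : R) f : 0 <= a -> dual_le 0 f -> dual_le 0 (a *: f).
Proof. by move=> a0 f0 x x0; apply: mulr_ge0 => //; exact: f0. Qed.

Section PositivePart.
Variable f : dual E.

Let S x := [set f y | y in [set y | 0 <=v y /\ y <=v x]].

(* Riesz-Kantorovich formula for the positive part of [f] on the cone. *)
Definition dual_pos_cone x : R := sup (S x).
Local Notation fp := dual_pos_cone.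

Let S_ub x : 0 <=v x -> ubound (S x) (`|f| * `|x|).
Proof.
move=> x0 _ [y [y0 yx] <-]; apply: le_trans (ler_norm _) _.
by apply: le_trans (dual_norm_le _ _) _; rewrite ler_wpM2l//; exact: vnorm_pos.
Qed.

Let S_le x y : 0 <=v y -> y <=v x -> f y <= fp x.
Proof.
move=> y0 yx; apply: ub_le_sup; last by exists y.
by exists (`|f| * `|x|); apply: S_ub; exact: vle_trans yx.
Qed.

Let fp_le x M : 0 <=v x -> (forall y, 0 <=v y -> y <=v x -> f y <= M) ->
  fp x <= M.
Proof.
move=> x0 h; apply: ge_sup; last by move=> _ [y [y0 yx] <-]; exact: h.
by exists (f 0), 0 => //; split=> //; exact: vle_refl.
Qed.

Let fp_ge0 x : 0 <=v x -> 0 <= fp x.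
Proof. by move=> x0; rewrite -(linear0 f); apply: S_le => //; exact: vle_refl. Qed.

Let fpD x y : 0 <=v x -> 0 <=v y -> fp (x + y) = fp x + fp y.
Proof.
move=> x0 y0; apply/eqP; rewrite eq_le; apply/andP; split.
  apply: fp_le => [|z z0 zxy]; first exact: vaddr_ge0.
  have [z1 [z2 [-> [z10 z1x] [z20 z2y]]]] := riesz_decomposition x0 y0 z0 zxy.
  by rewrite linearD; apply: lerD; exact: S_le.
rewrite -lerBrDr; apply: fp_le => // y1 y10 y1x; rewrite lerBrDr addrC -lerBrDr.
apply: fp_le => // y2 y20 y2y; rewrite lerBrDr -linearD; apply: S_le.
  exact: vaddr_ge0.
by rewrite addrC; exact: vleD.
Qed.

Let fpZ_le (a : R) x : 0 < a -> 0 <=v x -> a * fp x <= fp (a *: x).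
Proof.
move=> a0 x0; rewrite mulrC -ler_pdivlMr//; apply: fp_le => // y y0 yx.
rewrite ler_pdivlMr// mulrC -[_ * _]/(a *: f y) -linearZ; apply: S_le.
  by apply: vscale_ge0 => //; exact: ltW.
apply/vsubr_ge0; rewrite -scalerBr; apply: vscale_ge0; first exact: ltW.
exact/vsubr_ge0.
Qed.

Let fpZ (a : R) x : 0 <= a -> 0 <=v x -> fp (a *: x) = a * fp x.
Proof.
rewrite le_eqVlt => /orP[/eqP<- x0|a0 x0].
  rewrite scale0r mul0r; apply/eqP; rewrite eq_le fp_ge0 ?andbT; last first.
    exact: vle_refl.
  by have := fpD x0 (vle_refl 0); rewrite addr0; lra.
apply/eqP; rewrite eq_le fpZ_le// andbT.
have := @fpZ_le a^-1 (a *: x); rewrite scalerA mulVf ?gt_eqF// scale1r.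
rewrite mulrC ler_pdivrMr// mulrC; apply; first by rewrite invr_gt0.
by apply: vscale_ge0 => //; exact: ltW.
Qed.

Let hf x : R := fp (vpos x) - fp (vpos (- x)).

Let hfE x y z : 0 <=v y -> 0 <=v z -> x = y - z -> hf x = fp y - fp z.
Proof.
move=> y0 z0 xyz.
have e : vpos x + z = y + vpos (- x).
  have /(congr1 (fun t => t + vpos (- x) + z)) := vposB x.
  by rewrite subrK {1}xyz addrAC subrK.
have := congr1 fp e; rewrite !fpD//; try exact: vpos_ge0.
by rewrite /hf; lra.
Qed.

Let hf_linear : linear hf.
Proof.
move=> a x y.
have p0 := @vpos_ge0 _ E.
have hfZ : hf (a *: x) = a * hf x.
  have [a0|a0] := leP 0 a.
    rewrite (hfE (vscale_ge0 a0 (p0 x)) (vscale_ge0 a0 (p0 (- x)))).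
      by rewrite !fpZ// /hf; lra.
    by rewrite -scalerBr -vposB.
  have a0' : 0 <= - a by rewrite oppr_ge0 ltW.
  rewrite (hfE (vscale_ge0 a0' (p0 (- x))) (vscale_ge0 a0' (p0 x))).
    by rewrite !fpZ// /hf; lra.
  by rewrite -scalerBr scaleNr -scalerN opprB -vposB.
rewrite -[_ *: hf x]/(a * hf x) -hfZ; move: {hfZ}(a *: x) => {}x.
rewrite (hfE (vaddr_ge0 (p0 x) (p0 y)) (vaddr_ge0 (p0 (- x)) (p0 (- y)))).
  by rewrite !fpD// /hf; lra.
by rewrite opprD addrACA -!vposB.
Qed.

Let hf_bound x : `|hf x| <= (`|f| + `|f|) * `|x|.
Proof.
have b y : `|fp (vpos y)| <= `|f| * `|y|.
  rewrite ger0_norm ?fp_ge0//; last exact: vpos_ge0.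
  apply: (@le_trans _ _ (`|f| * `|vpos y|)).
    apply: ge_sup; last by apply: S_ub; exact: vpos_ge0.
    by exists (f 0), 0 => //; split; [exact: vle_refl|exact: vpos_ge0].
  by rewrite ler_wpM2l// vpos_norm.
apply: le_trans (ler_normB _ _) _; rewrite mulrDl; apply: lerD => //.
by rewrite -(normrN x).
Qed.

Definition dual_pos : dual E := Dual (dual_bounded_continuous hf_linear hf_bound).

Lemma dual_posE x : 0 <=v x -> dual_pos x = dual_pos_cone x.
Proof.
move=> x0; rewrite /= (hfE x0 (vle_refl 0)) ?subr0//.
by have := fpZ (lexx 0) x0; rewrite scale0r mul0r => ->; rewrite subr0.
Qed.

Lemma dual_pos_cone_le x M : 0 <=v x ->
  (forall y, 0 <=v y -> y <=v x -> f y <= M) -> dual_pos_cone x <= M.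
Proof. exact: fp_le. Qed.

Lemma dual_pos_ge0 : dual_le 0 dual_pos.
Proof. by move=> x x0; rewrite dual_posE// fp_ge0. Qed.

Lemma dual_pos_ge : dual_le f dual_pos.
Proof. by move=> x x0; rewrite dual_posE// S_le//; exact: vle_refl. Qed.

Lemma dual_pos_least g : dual_le 0 g -> dual_le f g -> dual_le dual_pos g.
Proof.
move=> g0 fg x x0; rewrite dual_posE//; apply: fp_le => // y y0 yx.
apply: le_trans (fg _ y0) _; rewrite -subr_ge0 -linearB.
by apply: g0; exact/vsubr_ge0.
Qed.

End PositivePart.

Definition dual_join f g : dual E := dual_pos (f - g) + g.

Lemma dual_joinP f g h :
  dual_le (dual_join f g) h <-> dual_le f h /\ dual_le g h.
Proof.
split=> [jh|[fh gh]].
  split; apply: dual_le_trans jh.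
    by have := dual_leD2r g (dual_pos_ge (f - g)); rewrite subrK.
  by have := dual_leD2r g (dual_pos_ge0 (f - g)); rewrite add0r.
have := @dual_pos_least (f - g) (h - g) => /(_ _ _)/(dual_leD2r g).
rewrite subrK; apply; last exact: dual_leD2r.
by have := dual_leD2r (- g) gh; rewrite subrr.
Qed.

Lemma dual_norm_le_abs f g :
  dual_le (dual_join f (- f)) (dual_join g (- g)) -> `|f| <= `|g|.
Proof.
set af := dual_join f (- f); set ag := dual_join g (- g) => fg.
have [faf Nfaf] := proj1 (dual_joinP f (- f) af) (dual_le_refl af).
have agE z : 0 <=v z -> ag z <= `|g| * `|z|.
  move=> z0; rewrite -[ag z]/(dual_pos (g - - g) z - g z) lerBlDr dual_posE//.
  apply: dual_pos_cone_le => // y y0 yz; rewrite -[_ y]/(g y - - g y) opprK.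
  have -> : g y + g y = g (y + y - z) + g z by rewrite linearB linearD /=; lra.
  rewrite lerD2r; apply: le_trans (ler_norm _) _.
  apply: le_trans (dual_norm_le _ _) _; apply: ler_wpM2l => //.
  apply: vnorm_interval; apply/vsubr_ge0.
    by rewrite opprK subrK; exact: vaddr_ge0.
  rewrite opprB opprD addrA addrACA.
  by apply: vaddr_ge0; exact/vsubr_ge0.
apply: supnorm_le_ball => x x1; apply: (@le_trans _ _ (`|g| * `|x|)); last first.
  by rewrite -[leRHS]mulr1 ler_wpM2l.
rewrite -(vnorm_vabs x); apply: le_trans (agE _ (vabs_ge0 x)).
apply: le_trans (fg _ (vabs_ge0 x)).
have fy y : 0 <=v y -> `|f y| <= af y.
  move=> y0; rewrite ler_norml faf// andbT lerNl.
  exact: Nfaf.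
have p1 : 0 <=v vabs x + x.
  by rewrite -[X in _ + X]opprK; apply/vsubr_ge0; exact: vjoin_r.
have p2 : 0 <=v vabs x - x by apply/vsubr_ge0; exact: vjoin_l.
have := fy _ p1; have := fy _ p2; rewrite !linearD !linearN /=.
by rewrite !ler_norml => /andP[? ?] /andP[? ?]; apply/andP; split; lra.
Qed.

HB.instance Definition _ := isBanachLattice.Build R (dual E)
  dual_le_refl dual_le_anti dual_le_trans dual_joinP dual_leD2r dual_scale_ge0
  dual_norm_le_abs.

End DualLattice.

Section Polynomials.
Context {R : realType}.

Definition multilinear (m : nat) (E F : lmodType R) (A : ('I_m -> E) -> F) :=
  forall (i : 'I_m) (x : 'I_m -> E),
    linear (fun t : E => A (@dfwith _ (fun=> E) x i t)).

Definition assoc_symmetric_form (m : nat) (E F : lmodType R) (P : E -> F)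
    (A : ('I_m -> E) -> F) :=
  [/\ multilinear A,
      forall (s : 'S_m) (x : 'I_m -> E), A (x \o s) = A x
    & forall x, P x = A (fun=> x)].

Definition hpoly (m : nat) (E F : normedModType R) : set (E -> F) :=
  [set P | continuous P /\
    exists A : ('I_m -> E) -> F, assoc_symmetric_form P A].

Definition pos_poly (m : nat) (E F : banachLatticeType R) : set (E -> F) :=
  [set P | continuous P /\
    exists2 A : ('I_m -> E) -> F, assoc_symmetric_form P A &
      forall x, (forall i, 0 <=v x i) -> 0 <=v A x].

Definition regular_poly (m : nat) (E F : banachLatticeType R) : set (E -> F) :=
  [set P | exists P1 P2, [/\ pos_poly m P1, pos_poly m P2 & P = P1 - P2]].

Definition poly_le (m : nat) (E F : banachLatticeType R) (P Q : E -> F) :=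
  pos_poly m (Q - P).

Definition is_poly_modulus (m : nat) (E : banachLatticeType R)
    (phi psi : E -> R) :=
  [/\ regular_poly m psi, poly_le m phi psi, poly_le m (- phi) psi &
      forall theta : E -> R, regular_poly m theta ->
        poly_le m phi theta -> poly_le m (- phi) theta -> poly_le m psi theta].

(* The regular polynomials form a lattice for [poly_le], so [get] picks the
   unique modulus when [phi] is regular. *)
Definition poly_modulus (m : nat) (E : banachLatticeType R) (phi : E -> R)
    : E -> R :=
  get (is_poly_modulus m phi).

Definition regular_norm (m : nat) (E : banachLatticeType R) (phi : E -> R) : R :=
  supnorm (poly_modulus m phi).

Definition pos_regular_ball (m : nat) (E : banachLatticeType R) : set (E -> R) :=
  [set phi | pos_poly m phi /\ regular_norm m phi <= 1].

End Polynomials.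

Section Dominated.
Context {R : realType}.

Definition lp_norm (p : \bar R) (n : nat) (a : 'I_n -> R) : R :=
  if p is p%:E then (\sum_i `|a i| `^ p) `^ p^-1
  else \big[Num.max/0]_i `|a i|.

(* The real suprema in [weak_norm] and [poly_weak_norm] are over nonempty sets,
   bounded above by [lp_norm r (fun i => `|y i|)] and
   [lp_norm q (fun i => `|x i| ^+ m)] respectively. *)
Definition weak_norm (r : \bar R) (G : banachLatticeType R) (n : nat)
    (y : 'I_n -> G) : R :=
  sup [set lp_norm r (fun i => xi (vabs (y i)))
      | xi in [set xi : dual G | `|xi| <= 1 /\ 0 <=v xi]].

Definition poly_weak_norm (q : \bar R) (m : nat) (E : banachLatticeType R)
    (n : nat) (x : 'I_n -> E) : R :=
  sup [set lp_norm q (fun i => phi (x i)) | phi in pos_regular_ball m (E := E)].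

Definition dominated_by (p q r : \bar R) (m : nat) (E F : banachLatticeType R)
    (P : E -> F) (C : R) :=
  forall (n : nat) (x : 'I_n -> E) (y : 'I_n -> dual F),
    (forall i, 0 <=v x i) -> (forall i, 0 <=v y i) ->
    lp_norm p (fun i => y i (P (x i))) <=
      C * poly_weak_norm q m x * weak_norm r y.

Definition pos_weakly_dominated (p q r : \bar R) (m : nat)
    (E F : banachLatticeType R) : set (E -> F) :=
  [set P | hpoly m P /\ exists2 C : R, 0 < C & dominated_by p q r m P C].

Definition dominated_norm (p q r : \bar R) (m : nat)
    (E F : banachLatticeType R) (P : E -> F) : R :=
  inf [set C : R | 0 < C /\ dominated_by p q r m P C].

End Dominated.

Section PolynomialIdeals.
Context {R : realType}.

Definition pos_operator (E F : banachLatticeType R) (u : {linear E -> F}) :=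
  continuous u /\ forall x, 0 <=v x -> 0 <=v u x.

(* [cls m E F] is the component of [m]-homogeneous members from [E] to [F] and
   [nrm m E F] the norm on it, meaningful on [cls m E F] only. *)
Record pos_banach_poly_ideal
    (cls : forall (m : nat) (E F : banachLatticeType R), set (E -> F))
    (nrm : forall (m : nat) (E F : banachLatticeType R), (E -> F) -> R) : Prop :=
  PosBanachPolyIdeal {
  ideal_hpoly : forall m (E F : banachLatticeType R), (0 < m)%N ->
    cls m E F `<=` hpoly m (F := F) ;
  ideal_0 : forall m (E F : banachLatticeType R), (0 < m)%N -> cls m E F 0 ;
  ideal_D : forall m (E F : banachLatticeType R) (P Q : E -> F), (0 < m)%N ->
    cls m E F P -> cls m E F Q -> cls m E F (P + Q) ;
  ideal_Z : forall m (E F : banachLatticeType R) (a : R) (P : E -> F),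
    (0 < m)%N -> cls m E F P -> cls m E F (a *: P) ;
  ideal_finite_type : forall m (E F : banachLatticeType R) (k : nat)
      (phi : 'I_k -> dual E) (y : 'I_k -> F), (0 < m)%N ->
    cls m E F (fun x => \sum_(i < k) (phi i x ^+ m) *: y i) ;
  ideal_comp : forall m (E F G H : banachLatticeType R) (P : E -> F)
      (u : {linear G -> E}) (v : {linear F -> H}), (0 < m)%N ->
    cls m E F P -> pos_operator u -> pos_operator v ->
    cls m G H (v \o P \o u) ;
  ideal_norm_ge0 : forall m (E F : banachLatticeType R) (P : E -> F),
    (0 < m)%N -> cls m E F P -> 0 <= nrm m E F P ;
  ideal_norm_eq0 : forall m (E F : banachLatticeType R) (P : E -> F),
    (0 < m)%N -> cls m E F P -> nrm m E F P = 0 -> P = 0 ;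
  ideal_normZ : forall m (E F : banachLatticeType R) (a : R) (P : E -> F),
    (0 < m)%N -> cls m E F P -> nrm m E F (a *: P) = `|a| * nrm m E F P ;
  ideal_normD : forall m (E F : banachLatticeType R) (P Q : E -> F),
    (0 < m)%N -> cls m E F P -> cls m E F Q ->
    nrm m E F (P + Q) <= nrm m E F P + nrm m E F Q ;
  ideal_complete : forall m (E F : banachLatticeType R) (P_ : nat -> E -> F),
    (0 < m)%N -> (forall k, cls m E F (P_ k)) ->
    (forall e : R, 0 < e -> exists N : nat, forall i j : nat,
       (N <= i)%N -> (N <= j)%N -> nrm m E F (P_ i - P_ j) < e) ->
    exists2 P : E -> F, cls m E F P &
      nrm m E F (P_ k - P) @[k --> \oo] --> (0 : R) ;
  ideal_norm_power : forall m, (0 < m)%N ->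
    nrm m R R (fun x : R => x ^+ m) = 1 ;
  ideal_norm_comp : forall m (E F G H : banachLatticeType R) (P : E -> F)
      (u : {linear G -> E}) (v : {linear F -> H}), (0 < m)%N ->
    cls m E F P -> pos_operator u -> pos_operator v ->
    nrm m G H (v \o P \o u) <= supnorm v * nrm m E F P * supnorm u ^+ m }.

End PolynomialIdeals.

(* Main.v *)
(* Everything is tested on one-term families first: for x, y* >= 0 domination
   gives |<y*, P x>| <= C |x|^m |y*|, and a norming functional split into its
   positive and negative parts turns this into |P x| <= 2 C |x|^m on the cone.
   Along t |-> x^+ + t x^- a polynomial has degree at most m, so P x is a fixed
   combination of the values P (x^+ + k x^-) with 0 <= k <= m; hence the
   dominated norm controls the supremum norm.  This gives definiteness and
   reduces completeness to uniform convergence on balls: the limit is again a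
   homogeneous polynomial by the polarization formula, and the defining
   inequalities pass to the limit term by term.  A positive scalar polynomial
   is its own modulus, so a positive phi divided by its supremum norm may be
   used in the weak norms; with evaluations as positive functionals on F^*,
   Hoelder's inequality yields the finite type polynomials and the norm of
   the power polynomial. *)
From HB Require Import structures.
Require Import Defs.
From mathcomp Require Import all_boot all_order all_algebra.
From mathcomp Require Import all_classical all_reals.
From mathcomp Require Import ereal topology normedtype exp.
From mathcomp Require Import interval_inference convex hoelder perm ring lra.
Set Implicit Arguments.
Unset Strict Implicit.
Unset Printing Implicit Defensive.
Import Order.TTheory GRing.Theory Num.Theory numFieldNormedType.Exports.
Local Open Scope classical_set_scope.
Local Open Scope ring_scope.

(** * Finite-dimensional lp norms *)

Section LpNorm.
Context {R : realType}.
Implicit Types (p q r : \bar R) (s : R) (n : nat).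

Lemma ge1_ereal_cases p : (1 <= p)%E -> (exists2 s, 1 <= s & p = s%:E) \/ p = +oo%E.
Proof. by case: p => [s||]//; rewrite ?lee_fin => s1; [left; exists s|right]. Qed.

Lemma powR_convex s (t x y : R) : 1 <= s -> 0 <= t <= 1 -> 0 <= x -> 0 <= y ->
  (t * x + (1 - t) * y) `^ s <= t * x `^ s + (1 - t) * y `^ s.
Proof.
move=> s1 /andP[t0 t1] x0 y0.
have := @convex_powR R s s1 (Itv01 t0 t1) x y.
rewrite !inE /= !in_itv /= !andbT !convRE /=; exact.
Qed.

Lemma bigmax_ge0 n (a : 'I_n -> R) : 0 <= \big[Num.max/0]_i `|a i|.
Proof. by apply: (big_ind (fun x => 0 <= x)) => // x y x0 y0; rewrite le_max x0. Qed.

Lemma bigmax_norm_ge n (a : 'I_n -> R) i : `|a i| <= \big[Num.max/0]_i `|a i|.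
Proof. exact: (@le_bigmax _ R _ 0 (fun i => `|a i|) i). Qed.

Lemma bigmax_norm_le n (a : 'I_n -> R) (M : R) : 0 <= M ->
  (forall i, `|a i| <= M) -> \big[Num.max/0]_i `|a i| <= M.
Proof.
move=> M0 aM; apply: (big_ind (fun x => x <= M)) => // x y xM yM.
by rewrite ge_max xM.
Qed.

Lemma lp_norm_ge0 p n (a : 'I_n -> R) : 0 <= lp_norm p a.
Proof. by case: p => [s||] /=; [exact: powR_ge0|exact: bigmax_ge0..]. Qed.

Lemma ler_lp_norm p n (a b : 'I_n -> R) : (1 <= p)%E ->
  (forall i, `|a i| <= `|b i|) -> lp_norm p a <= lp_norm p b.
Proof.
move=> /ge1_ereal_cases[[s s1 ->]|->] ab /=; last first.
  apply: bigmax_norm_le => [|i]; first exact: bigmax_ge0.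
  by apply: le_trans (ab i) _; exact: bigmax_norm_ge.
have s0 : 0 <= s by rewrite (le_trans ler01).
have Sge0 (c : 'I_n -> R) : \sum_i `|c i| `^ s \is Num.nneg.
  by rewrite nnegrE; apply: sumr_ge0 => i _; exact: powR_ge0.
apply: ge0_ler_powR; rewrite ?invr_ge0//.
by apply: ler_sum => i _; apply: ge0_ler_powR => //; rewrite nnegrE.
Qed.

Lemma lp_normZ p n (c : R) (a : 'I_n -> R) : (1 <= p)%E ->
  lp_norm p (fun i => c * a i) = `|c| * lp_norm p a.
Proof.
move=> /ge1_ereal_cases[[s s1 ->]|->] /=; last first.
  apply: (big_rec2 (fun x y => x = `|c| * y)); first by rewrite mulr0.
  by move=> i x y _ ->; rewrite normrM maxr_pMr.
have s0 : s != 0 by rewrite gt_eqF// (lt_le_trans ltr01).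
under eq_bigr do rewrite normrM powRM//.
rewrite -mulr_sumr powRM ?powR_ge0//; last by apply: sumr_ge0 => i _; exact: powR_ge0.
by rewrite -powRrM mulfV// powRr1.
Qed.

Lemma lp_norm_ge p n (a : 'I_n -> R) i : (1 <= p)%E -> `|a i| <= lp_norm p a.
Proof.
move=> /ge1_ereal_cases[[s s1 ->]|->] /=; last by exact: bigmax_norm_ge.
have s0 : 0 < s by rewrite (lt_le_trans ltr01).
rewrite -[leLHS]powRr1// -(@mulfV _ s) ?gt_eqF// powRrM.
apply: ge0_ler_powR; rewrite ?nnegrE ?powR_ge0 ?invr_ge0 ?(ltW s0)//.
  by apply: sumr_ge0 => j _; exact: powR_ge0.
by rewrite (bigD1 i)//= lerDl; apply: sumr_ge0 => j _; exact: powR_ge0.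
Qed.

Lemma lp_norm_eq0 p n (a : 'I_n -> R) : (1 <= p)%E ->
  lp_norm p a = 0 -> a = fun=> 0.
Proof.
move=> p1 a0; apply/funext => i; apply/eqP; rewrite -normr_le0 -a0.
exact: lp_norm_ge.
Qed.

Lemma lp_norm0 p n : (1 <= p)%E -> lp_norm p (fun _ : 'I_n => 0) = 0.
Proof.
move=> p1; have := @lp_normZ p n 0 (fun=> 0) p1.
rewrite normr0 [RHS]mul0r; apply: etrans.
by congr (lp_norm p); apply/funext => i; rewrite mul0r.
Qed.

(** Raising to the power [s] trades a norm bound for a bound on a sum, where convexity or Young's
    inequality can be applied term by term. *)
Lemma lp_norm_le_unit s n (a : 'I_n -> R) (M : R) : 1 <= s -> 0 < M ->
  (lp_norm s%:E a <= M) = (\sum_i (`|a i| / M) `^ s <= 1).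
Proof.
move=> s1 M0; have s0 : 0 < s by rewrite (lt_le_trans ltr01).
have s00 : s != 0 by rewrite gt_eqF.
have Sge0 (b : 'I_n -> R) : 0 <= \sum_i (b i) `^ s.
  by apply: sumr_ge0 => j _; exact: powR_ge0.
have -> : \sum_i (`|a i| / M) `^ s = (\sum_i `|a i| `^ s) * (M `^ s)^-1.
  rewrite mulr_suml; apply: eq_bigr => i _.
  rewrite powRM ?invr_ge0 ?(ltW M0)//; congr (_ * _).
  rewrite -(powR_inv1 (ltW M0)) -powRrM mulrC powRrM powR_inv1//.
  exact: powR_ge0.
rewrite ler_pdivrMr ?powR_gt0// mul1r /=; apply/idP/idP => h.
  have := @ge0_ler_powR R s (ltW s0) _ _ _ _ h.
  rewrite -powRrM mulVf// powRr1//; apply; rewrite nnegrE ?powR_ge0//.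
  exact: ltW.
have := @ge0_ler_powR R s^-1 _ _ _ _ _ h.
rewrite -powRrM mulfV// (powRr1 (ltW M0)).
by apply; rewrite ?nnegrE ?invr_ge0 ?powR_ge0//; exact: ltW.
Qed.

(* The unit ball is convex because [powR ^~ s] is. *)
Lemma lp_normD p n (a b : 'I_n -> R) : (1 <= p)%E ->
  lp_norm p (fun i => a i + b i) <= lp_norm p a + lp_norm p b.
Proof.
move=> p1.
have [/(lp_norm_eq0 p1) ->|a0] := eqVneq (lp_norm p a) 0.
  rewrite lp_norm0// add0r; apply: ler_lp_norm => // i; by rewrite add0r.
have [/(lp_norm_eq0 p1) ->|b0] := eqVneq (lp_norm p b) 0.
  rewrite lp_norm0// addr0; apply: ler_lp_norm => // i; by rewrite addr0.
have {}a0 : 0 < lp_norm p a by rewrite lt_def a0 lp_norm_ge0.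
have {}b0 : 0 < lp_norm p b by rewrite lt_def b0 lp_norm_ge0.
(* The norms are generalised to [A] and [B], keeping only [lp_norm p a <= A] and [lp_norm p b <= B],
   the form that [lp_norm_le_unit] expects. *)
move: (lexx (lp_norm p a)) (lexx (lp_norm p b)) a0 b0.
move: {2 3 4}(lp_norm p a) {2 3 4}(lp_norm p b) => A B.
case: (ge1_ereal_cases p1) => [[s s1 ->]|->] aA bB A0 B0; last first.
  have AB0 : 0 <= A + B by rewrite addr_ge0// ltW.
  apply: bigmax_norm_le => // i.
  apply: le_trans (ler_normD _ _) _; apply: lerD.
    by apply: le_trans aA; exact: bigmax_norm_ge.
  by apply: le_trans bB; exact: bigmax_norm_ge.
have s0 : 0 <= s by rewrite (le_trans ler01).
have AB0 : 0 < A + B by rewrite addr_gt0.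
rewrite lp_norm_le_unit// in aA; rewrite lp_norm_le_unit// in bB.
rewrite lp_norm_le_unit//.
(* With this weight, [(|a i| + |b i|) / (A + B)] is the convex combination of [|a i| / A] and
   [|b i| / B]. *)
pose t := A / (A + B).
have t01 : 0 <= t <= 1.
  by rewrite divr_ge0 ?(ltW A0) ?(ltW AB0)//= ler_pdivrMr// mul1r lerDl ltW.
have tE : 1 - t = B / (A + B) by rewrite /t; field; rewrite gt_eqF.
apply: (@le_trans _ _ (\sum_i (t * (`|a i| / A) `^ s + (1 - t) * (`|b i| / B) `^ s))).
  apply: ler_sum => i _.
  apply: le_trans (powR_convex s1 t01 _ _); rewrite ?divr_ge0 ?(ltW A0) ?(ltW B0)//.
  apply: ge0_ler_powR; rewrite ?nnegrE ?divr_ge0 ?(ltW AB0)//.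
    case/andP: t01 => t0 t1.
    by rewrite addr_ge0// mulr_ge0 ?divr_ge0 ?subr_ge0// ltW.
  rewrite ler_pdivrMr// tE.
  have -> : (t * (`|a i| / A) + B / (A + B) * (`|b i| / B)) * (A + B) = `|a i| + `|b i|.
    by rewrite /t; field; rewrite !gt_eqF.
  exact: ler_normD.
rewrite big_split /= -!mulr_sumr.
rewrite -[leRHS](_ : t * 1 + (1 - t) * 1 = 1); last by ring.
by case/andP: t01 => t0 t1; apply: lerD; apply: ler_wpM2l => //; rewrite subr_ge0.
Qed.

Lemma lp_norm1 p (a : 'I_1 -> R) : (1 <= p)%E -> lp_norm p a = `|a ord0|.
Proof.
move=> /ge1_ereal_cases[[s s1 ->]|->] /=; last by rewrite big_ord_recl big_ord0 max_l.
have s0 : s != 0 by rewrite gt_eqF// (lt_le_trans ltr01).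
by rewrite big_ord_recl big_ord0 addr0 -powRrM mulfV// powRr1.
Qed.

(** If [q] or [r] is infinite, a maximum is pulled out. For finite exponents both norms are
    normalised and Young's inequality with the conjugate exponents [q / p] and [r / p] is summed. *)
Lemma hoelder_lp_norm p q r n (a b : 'I_n -> R) :
  (1 <= p)%E -> (1 <= q)%E -> (1 <= r)%E -> (p^-1 = q^-1 + r^-1)%E ->
  lp_norm p (fun i => a i * b i) <= lp_norm q a * lp_norm r b.
Proof.
move=> p1 q1 r1 pqr.
have maxl (s : \bar R) (u v : 'I_n -> R) : (1 <= s)%E ->
    lp_norm s (fun i => u i * v i) <= lp_norm +oo%E u * lp_norm s v.
  move=> s1; have u0 := lp_norm_ge0 +oo%E u.
  rewrite -[X in _ <= X * _](ger0_norm u0) -lp_normZ//.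
  apply: ler_lp_norm => // i; rewrite !normrM ler_wpM2r//.
  by rewrite (ger0_norm u0); apply: lp_norm_ge; rewrite leey.
case: (ge1_ereal_cases q1) => {q1} [[{}q q1 ->]|->] in pqr *; last first.
  (* The reciprocal of the infinite [q] is zero, so [r] and [p] have the same reciprocal. *)
  rewrite (_ : r = p); first exact: maxl.
  by apply: constructive_ereal.invr_inj; rewrite pqr invey add0e.
case: (ge1_ereal_cases r1) => {r1} [[{}r r1 ->]|->] in pqr *; last first.
  rewrite (_ : p = q%:E) in p1 *; last first.
    by apply: constructive_ereal.invr_inj; rewrite pqr invey adde0.
  rewrite (_ : (fun i => a i * b i) = fun i => b i * a i); last first.
    by apply/funext => i; rewrite mulrC.
  by rewrite mulrC; exact: maxl.
have q0 : 0 < q by rewrite (lt_le_trans ltr01).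
have r0 : 0 < r by rewrite (lt_le_trans ltr01).
rewrite !inver !gt_eqF//= -EFinD in pqr.
case: (ge1_ereal_cases p1) => {p1} [[{}p p1 ->]|->] in pqr *; last first.
  (* An infinite [p] would make the positive sum [q^-1 + r^-1] vanish. *)
  by move: pqr => [/eqP]; rewrite lt_eqF// addr_gt0 ?invr_gt0.
have p0 : 0 < p by rewrite (lt_le_trans ltr01).
move: pqr; rewrite inver gt_eqF// => -[pqr].
have [a0|a0] := eqVneq (lp_norm q%:E a) 0.
  rewrite a0 mul0r (_ : (fun i => _) = fun=> 0) ?lp_norm0//.
  by apply/funext => i; rewrite (@lp_norm_eq0 q%:E n a)// mul0r.
have [b0|b0] := eqVneq (lp_norm r%:E b) 0.
  rewrite b0 mulr0 (_ : (fun i => _) = fun=> 0) ?lp_norm0//.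
  by apply/funext => i; rewrite (@lp_norm_eq0 r%:E n b)// mulr0.
have {}a0 : 0 < lp_norm q%:E a by rewrite lt_def a0 lp_norm_ge0.
have {}b0 : 0 < lp_norm r%:E b by rewrite lt_def b0 lp_norm_ge0.
move: (lexx (lp_norm q%:E a)) (lexx (lp_norm r%:E b)) a0 b0.
move: {2 3 4}(lp_norm q%:E a) {2 3 4}(lp_norm r%:E b) => A B aA bB A0 B0.
rewrite lp_norm_le_unit// in aA; rewrite lp_norm_le_unit// in bB.
rewrite lp_norm_le_unit ?mulr_gt0//.
have pq1 : (q / p)^-1 + (r / p)^-1 = 1.
  by rewrite !invf_div -mulrDr -pqr mulfV// gt_eqF.
apply: (@le_trans _ _ (\sum_i ((q / p)^-1 * (`|a i| / A) `^ q +
                               (r / p)^-1 * (`|b i| / B) `^ r))).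
  apply: ler_sum => i _.
  have ga : 0 <= `|a i| / A by rewrite divr_ge0// ltW.
  have gb : 0 <= `|b i| / B by rewrite divr_ge0// ltW.
  have -> : `|a i * b i| / (A * B) = (`|a i| / A) * (`|b i| / B).
    by rewrite normrM; field; rewrite !gt_eqF.
  rewrite powRM//.
  have := @conjugate_powR R _ _ (q / p) (r / p) (powR_ge0 (`|a i| / A) p)
    (powR_ge0 (`|b i| / B) p) (divr_gt0 q0 p0) (divr_gt0 r0 p0) pq1.
  rewrite -!powRrM !(mulrC p) !divfK ?gt_eqF//.
  by rewrite ![(_ / p)^-1 * _]mulrC.
rewrite big_split /= -!mulr_sumr.
rewrite -[leRHS](_ : (q / p)^-1 * 1 + (r / p)^-1 * 1 = 1); last by rewrite !mulr1.
by apply: lerD; apply: ler_wpM2l => //; rewrite invr_ge0 divr_ge0// ltW.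
Qed.

End LpNorm.

(** * Hahn-Banach through minimal sublinear functionals *)

Section Sublinear.
Context {R : realType} {E : lmodType R}.
Implicit Types (p q : E -> R) (x y z : E) (a t u M : R).

Definition sublinear q :=
  (forall x y, q (x + y) <= q x + q y) /\
  (forall a x, 0 <= a -> q (a *: x) <= a * q x).

Lemma sublinear0 q : sublinear q -> q 0 = 0.
Proof.
move=> [qD qZ]; have := qD 0 0; have := qZ 0 0 (lexx 0).
by rewrite addr0 scale0r mul0r; lra.
Qed.

Lemma sublinearZ q a x : sublinear q -> 0 <= a -> q (a *: x) = a * q x.
Proof.
move=> sq; rewrite le_eqVlt => /predU1P[<-|a0].
  by rewrite scale0r mul0r sublinear0.
apply/eqP; rewrite eq_le sq.2 ?(ltW a0)//=.
have ai : 0 <= a^-1 by rewrite invr_ge0 ltW.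
have := sq.2 _ (a *: x) ai; rewrite scalerA mulVf ?gt_eqF// scale1r.
by rewrite mulrC ler_pdivlMr// mulrC.
Qed.

Lemma sublinearN q x : sublinear q -> - q (- x) <= q x.
Proof. by move=> sq; have := sq.1 x (- x); rewrite subrr sublinear0//; lra. Qed.

(* The largest sublinear functional below [q] with value [- q y] at [- y]. *)
Definition sublinear_drop q y x : R :=
  inf [set q (x + t *: y) - t * q y | t in [set t | 0 <= t]].

Section Drop.
Variables (q : E -> R) (y : E).
Hypothesis sq : sublinear q.

Let S x := [set q (x + t *: y) - t * q y | t in [set t | 0 <= t]].

Let S_lb x : has_lbound (S x).
Proof.
exists (- q (- x)) => _ [t /= t0 <-].
have := sq.1 (x + t *: y) (- x); rewrite addrAC subrr add0r.
by rewrite sublinearZ//; lra.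
Qed.

Let S_ne x : S x !=set0.
Proof. by exists (q (x + 0 *: y) - 0 * q y); exists 0 => //=; rewrite lexx. Qed.

Lemma sublinear_drop_le_at x t : 0 <= t ->
  sublinear_drop q y x <= q (x + t *: y) - t * q y.
Proof. by move=> t0; apply: (ge_inf (S_lb x)); exists t. Qed.

Let drop_ge x M : (forall t, 0 <= t -> M <= q (x + t *: y) - t * q y) ->
  M <= sublinear_drop q y x.
Proof. by move=> h; apply: (lb_le_inf (S_ne x)) => _ [t /= t0 <-]; exact: h. Qed.

Lemma sublinear_drop_le x : sublinear_drop q y x <= q x.
Proof.
have := sublinear_drop_le_at x (lexx 0).
by rewrite scale0r addr0 mul0r subr0.
Qed.

(** For subadditivity, the parameters [t] and [u] chosen for the two arguments combine into the
    admissible [t + u]; for a positive factor [a], the parameter is rescaled to [a * t]. *)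
Lemma sublinear_drop_sublinear : sublinear (sublinear_drop q y).
Proof.
split=> [x z|a x a0].
  rewrite -lerBlDr; apply: drop_ge => t t0; rewrite lerBlDl -lerBlDr.
  apply: drop_ge => u u0; rewrite lerBlDr.
  apply: le_trans (sublinear_drop_le_at _ (addr_ge0 t0 u0)) _.
  have := sq.1 (x + t *: y) (z + u *: y); rewrite addrACA -scalerDl.
  by lra.
move: a0; rewrite le_eqVlt => /predU1P[<-|a0].
  rewrite scale0r mul0r; apply: le_trans (sublinear_drop_le _) _.
  by rewrite sublinear0.
rewrite -ler_pdivrMl//; apply: drop_ge => t t0.
rewrite ler_pdivrMl//.
apply: le_trans (sublinear_drop_le_at _ (mulr_ge0 (ltW a0) t0)) _.
by rewrite -scalerA -scalerDr sublinearZ ?(ltW a0)//; lra.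
Qed.

End Drop.

(** Zorn's lemma for the reversed pointwise order on the sublinear functionals below [p]. The
    pointwise infimum of a nonempty chain is finite, since every member is at least [- p (- x)] at
    [x], and it is again sublinear. *)
Lemma sublinear_minimal p : sublinear p -> exists q, [/\ sublinear q,
  forall x, q x <= p x &
  forall q', sublinear q' -> (forall x, q' x <= q x) -> forall x, q x <= q' x].
Proof.
move=> sp; pose T := {q : E -> R | sublinear q /\ forall x, q x <= p x}.
pose rl (f g : T) : bool := `[< forall x, sval g x <= sval f x >].
have [||A totA|[q [sq qp]] qmin] := @ZL_preorder T (exist _ p (conj sp (fun x => lexx (p x)))) rl.
- by move=> f; apply/asboolP.
- move=> f g h /asboolP fg /asboolP gh; apply/asboolP => x.
  exact: le_trans (gh x) (fg x).
(* The empty chain is bounded by [p] itself. *)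
- have [[f0 Af0]|/set0P/negP] := pselect (A !=set0); last first.
    rewrite negbK => /eqP ->.
    by exists (exist _ p (conj sp (fun x => lexx (p x)))).
  pose S x := [set sval f x | f in A].
  have S_lb x : has_lbound (S x).
    exists (- p (- x)) => _ [[f [sf fp]] _ <-] /=.
    by apply: le_trans (sublinearN _ sf); rewrite lerN2.
  have S_ne x : S x !=set0 by exists (sval f0 x), f0.
  have S_le f x : A f -> inf (S x) <= sval f x.
    by move=> Af; apply: ge_inf => //; exists f.
  have S_ge x M : (forall f, A f -> M <= sval f x) -> M <= inf (S x).
    by move=> h; apply: lb_le_inf => // _ [f Af <-]; exact: h.
  have sS : sublinear (fun x => inf (S x)).
    split=> [x y|a x a0].
      rewrite -lerBlDr; apply: (S_ge) => f Af; rewrite lerBlDl -lerBlDr.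
      apply: (S_ge) => g Ag; rewrite lerBlDr.
      (* The smaller of the two comparable members is evaluated at the sum; its subadditivity then
         gives the bound [f x + g y]. *)
      have [/asboolP fg|/asboolP gf] := totA _ _ Af Ag.
        apply: le_trans (S_le _ _ Ag) _; apply: le_trans ((svalP g).1.1 _ _) _.
        by rewrite addrC lerD2l.
      apply: le_trans (S_le _ _ Af) _; apply: le_trans ((svalP f).1.1 _ _) _.
      by rewrite addrC lerD2r.
    move: a0; rewrite le_eqVlt => /predU1P[<-|a0].
      rewrite scale0r mul0r; apply: le_trans (S_le _ _ Af0) _.
      by rewrite sublinear0//; exact: (svalP f0).1.
    rewrite -ler_pdivrMl//; apply: (S_ge) => f Af; rewrite ler_pdivrMl//.
    apply: le_trans (S_le _ _ Af) _.
    by apply: (svalP f).1.2; exact: ltW.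
  have Sp x : inf (S x) <= p x.
    by apply: le_trans (S_le _ _ Af0) _; exact: (svalP f0).2.
  pose g : T := exist _ (fun x => inf (S x)) (conj sS Sp).
  by exists g => f Af; apply/asboolP => x; exact: S_le.
- exists q; split=> // q' sq' q'q.
  have q'p x : q' x <= p x := le_trans (q'q x) (qp x).
  have /qmin/asboolP//= : rl (exist _ q (conj sq qp)) (exist _ q' (conj sq' q'p)).
  exact/asboolP.
Qed.

(** A minimal [q] cannot be lowered by dropping it along [y], and the parameter [t = 1] in the drop
    then gives [q x <= q (x + y) - q y]. So a minimal sublinear functional is additive, hence
    linear. *)
Lemma hahn_banach_sublinear p : sublinear p ->
  exists2 f : E -> R, linear f & forall x, f x <= p x.
Proof.
move=> /sublinear_minimal[q [sq qp qmin]]; exists q => //.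
have qD x y : q (x + y) = q x + q y.
  apply/eqP; rewrite eq_le sq.1 /=.
  have := qmin _ (sublinear_drop_sublinear y sq) (sublinear_drop_le y sq) x.
  have := sublinear_drop_le_at y sq x ler01.
  by rewrite scale1r mul1r; lra.
have qN x : q (- x) = - q x.
  by have := qD x (- x); rewrite subrr sublinear0//; lra.
move=> a x y; rewrite qD; congr (_ + _).
have [a0|a0] := leP 0 a; first exact: sublinearZ.
rewrite -[in LHS](opprK a) scaleNr qN sublinearZ ?oppr_ge0 ?(ltW a0)//.
by rewrite mulNr opprK.
Qed.

End Sublinear.

(** * Norming functionals *)

Section Norming.
Context {R : realType}.

Lemma sublinear_norm (E : normedModType R) : sublinear (fun x : E => `|x|).
Proof.
by split=> [x y|a x a0]; [exact: ler_normD|rewrite normrZ ger0_norm].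
Qed.

(** Hahn-Banach is applied not to the norm but to its drop along [z]. The drop is at most [- |z|] at
    [- z], which forces [f z >= |z|]. *)
Lemma norming_functional (E : normedModType R) (z : E) :
  exists2 f : dual E, `|f| <= 1 & f z = `|z|.
Proof.
have sn := sublinear_norm E.
have [f lf fp] := hahn_banach_sublinear (sublinear_drop_sublinear z sn).
have fn x : f x <= `|x| := le_trans (fp x) (sublinear_drop_le z sn x).
pose fL := GRing.isLinear.Build R E R *:%R f lf.
pose L : {linear E -> R} := HB.pack f fL.
have fN x : f (- x) = - f x by exact: (linearN L).
have fM x : `|f x| <= 1 * `|x|.
  rewrite mul1r ler_norml fn andbT lerNl -fN.
  by apply: le_trans (fn _) _; rewrite normrN.
exists (Dual (dual_bounded_continuous lf fM)) => /=.
  by apply: supnorm_le_ball => x x1; apply: le_trans (fM x) _; rewrite mul1r.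
apply/eqP; rewrite eq_le fn/=.
have := fp (- z); have := sublinear_drop_le_at z sn (- z) ler01.
by rewrite fN scale1r mul1r addNr normr0; lra.
Qed.

End Norming.

(** * Multilinear forms and homogeneous polynomials *)

Section Multilinear.
Context {R : realType}.

Lemma linear_sumZ (E F : lmodType R) (f : E -> F) (I : finType) (c : I -> R)
    (x : I -> E) : linear f -> f (\sum_i c i *: x i) = \sum_i c i *: f (x i).
Proof.
move=> lf; pose fL := GRing.isLinear.Build R E F *:%R f lf.
pose L : {linear E -> F} := HB.pack f fL.
by rewrite -[f]/(L : E -> F) linear_sum; apply: eq_bigr => i _; rewrite linearZ.
Qed.

(** Prepends an entry to a family; inductions on the number of variables use it to freeze the first
    argument. *)
Definition fcons (T : Type) m (e : T) (y : 'I_m -> T) : 'I_m.+1 -> T :=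
  fun j => oapp y e (unlift ord0 j).

Lemma fcons0 T m (e : T) (y : 'I_m -> T) : fcons e y ord0 = e.
Proof. by rewrite /fcons unlift_none. Qed.

Lemma fconsS T m (e : T) (y : 'I_m -> T) j : fcons e y (lift ord0 j) = y j.
Proof. by rewrite /fcons liftK. Qed.

Lemma fcons_eq T m (x z : 'I_m.+1 -> T) : x ord0 = z ord0 ->
  (forall j, x (lift ord0 j) = z (lift ord0 j)) -> x = z.
Proof. by move=> h0 hS; apply/funext => j; case: (unliftP ord0 j) => [k|] ->. Qed.

Lemma fcons_eta T m (x : 'I_m.+1 -> T) : x = fcons (x ord0) (x \o lift ord0).
Proof. by apply: fcons_eq => [|j]; rewrite ?fcons0 ?fconsS. Qed.

Lemma multilinear_fcons m (E F : lmodType R) (A : ('I_m.+1 -> E) -> F) e :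
  multilinear A -> multilinear (fun y => A (fcons e y)).
Proof.
move=> lA i x; have := lA (lift ord0 i) (fcons e x).
suff h t : @dfwith _ (fun=> E) (fcons e x) (lift ord0 i) t =
           fcons e (@dfwith _ (fun=> E) x i t).
  by move=> h' a s t; have := h' a s t; rewrite !h.
apply: fcons_eq => [|j]; first by rewrite fcons0 dfwithout ?fcons0// eq_sym neq_lift.
rewrite fconsS; have [<-|ij] := eqVneq i j; first by rewrite !dfwithin.
by rewrite !dfwithout ?fconsS// (inj_eq lift_inj).
Qed.

Lemma multilinear_fcons_linear m (E F : lmodType R) (A : ('I_m.+1 -> E) -> F) y :
  multilinear A -> linear (fun e => A (fcons e y)).
Proof.
move=> lA; have := lA ord0 (fcons 0 y).
suff h t : @dfwith _ (fun=> E) (fcons 0 y) ord0 t = fcons t y.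
  by move=> h' a s t; have := h' a s t; rewrite !h.
apply: fcons_eq => [|j]; first by rewrite fcons0 dfwithin.
by rewrite dfwithout ?fconsS// neq_lift.
Qed.

(** Induction on [m]: linearity in the first argument produces the sum over its index, and the
    induction hypothesis expands the form with that argument frozen. *)
Lemma multilinear_expand m (E F : lmodType R) (A : ('I_m -> E) -> F) (I : finType)
    (c : 'I_m -> I -> R) (X : 'I_m -> I -> E) : multilinear A ->
  A (fun j => \sum_i c j i *: X j i) =
  \sum_(f : {ffun 'I_m -> I}) (\prod_j c j (f j)) *: A (fun j => X j (f j)).
Proof.
elim: m A c X => [|m IH] A c X lA.
  have fE (T : Type) (x z : 'I_0 -> T) : x = z by apply/funext => -[].
  have f0 : {ffun 'I_0 -> I} by apply: finfun => -[].
  rewrite (bigD1 f0)//= big_ord0 scale1r big1 ?addr0; last first.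
    by move=> f /eqP[]; apply/ffunP => -[].
  by congr A; exact: fE.
have fpE (f : {ffun 'I_m.+1 -> I}) : f = [ffun j => fcons (f ord0) [ffun j => f (lift ord0 j)] j].
  apply/ffunP => j; rewrite ffunE; case: (unliftP ord0 j) => [k|] ->.
    by rewrite fconsS ffunE.
  by rewrite fcons0.
(* A choice function on [m.+1] slots amounts to a choice for the first slot and a choice function on
   the others. *)
rewrite (reindex (fun p : I * {ffun 'I_m -> I} => [ffun j => fcons p.1 p.2 j])) /=; last first.
  exists (fun f : {ffun 'I_m.+1 -> I} => (f ord0, [ffun j => f (lift ord0 j)])) => [[i f] _|f _].
    rewrite /= ffunE fcons0; congr pair; apply/ffunP => j.
    by rewrite !ffunE fconsS.
  by rewrite [RHS]fpE.
rewrite -(pair_big predT predT (fun i (f : {ffun 'I_m -> I}) =>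
  (\prod_j c j ([ffun j => fcons i f j] j)) *:
  A (fun j => X j ([ffun j => fcons i f j] j)))) /=.
rewrite [X in A X]fcons_eta.
rewrite (linear_sumZ (c ord0) (X ord0)
  (multilinear_fcons_linear ((fun j => \sum_i c j i *: X j i) \o lift ord0) lA)).
apply: eq_bigr => i _.
rewrite (IH (fun y => A (fcons (X ord0 i) y)) (fun j => c (lift ord0 j))
  (fun j => X (lift ord0 j)) (multilinear_fcons (X ord0 i) lA)).
rewrite scaler_sumr; apply: eq_bigr => f _; rewrite scalerA; congr (_ *: A _).
  rewrite big_ord_recl ffunE fcons0; congr (_ * _).
  by apply: eq_bigr => j _; rewrite ffunE fconsS.
by apply: fcons_eq => [|j]; rewrite ?fcons0 ?fconsS ffunE ?fcons0 ?fconsS.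
Qed.

(** Over the one-element index type [unit] the multilinear expansion has a single term. *)
Lemma multilinearZ m (E F : lmodType R) (A : ('I_m -> E) -> F) (c : 'I_m -> R)
    (x : 'I_m -> E) : multilinear A ->
  A (fun j => c j *: x j) = (\prod_j c j) *: A x.
Proof.
move=> lA; have := @multilinear_expand m E F A unit (fun j _ => c j) (fun j _ => x j) lA.
have sumu (V : zmodType) (g : unit -> V) : \sum_i g i = g tt.
  by rewrite (bigD1 tt)//= big1 ?addr0// => -[].
have -> : (fun j => \sum_(i : unit) c j *: x j) = (fun j => c j *: x j).
  by apply/funext => j; rewrite sumu.
move=> ->; rewrite (bigD1 [ffun=> tt])//= [X in _ + X]big1 ?addr0// => f /eqP[].
by apply/ffunP => j; case: (f j); rewrite ffunE.
Qed.

(* Summing over the sign patterns [e] first keeps only the injective [f]. *)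
Lemma polarization m (E F : lmodType R) (P : E -> F) (A : ('I_m -> E) -> F)
    (x : 'I_m -> E) : assoc_symmetric_form P A ->
  m`!%:R *: A x = \sum_(e : {ffun 'I_m -> bool})
    (\prod_i (if e i then 1 else -1)) *: P (\sum_i (e i)%:R *: x i).
Proof.
move=> [lA sA PA].
transitivity (\sum_(e : {ffun 'I_m -> bool}) \sum_(f : {ffun 'I_m -> 'I_m})
    ((\prod_i (if e i then 1 else -1)) * \prod_j (e (f j))%:R) *:
      A (fun j => x (f j))); last first.
  apply: eq_bigr => e _.
  rewrite PA (multilinear_expand (fun _ i => (e i)%:R) (fun _ i => x i) lA) scaler_sumr.
  by apply: eq_bigr => f _; rewrite scalerA.
rewrite exchange_big /=.
under eq_bigr do rewrite -scaler_suml.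
have codomE (f : {ffun 'I_m -> 'I_m}) : [forall i, i \in codom f] = injectiveb f.
  apply/forallP/injectiveP => [cf|fi i]; last exact: injF_onto.
  have /image_injP fi : #|codom f| == #|'I_m|.
    by apply/eqP; apply: eq_card => i; rewrite cf.
  by move=> i j; exact: fi.
have coefE (f : {ffun 'I_m -> 'I_m}) :
    \sum_(e : {ffun 'I_m -> bool}) (\prod_i (if e i then 1 else -1)) *
      \prod_j (e (f j))%:R = (injectiveb f)%:R :> R.
  (* The factors [e (f j)] kill every [e] that is false at a value of [f]. Absorbed into [G], they
     leave a pure product over [i], so the sum over [e] factorises; its factor at [i] is 1 if [i] is
     a value of [f] and 0 otherwise. *)
  pose G (i : 'I_m) (b : bool) : R := if b then 1 else - (i \notin codom f)%:R.
  transitivity (\sum_(e : {ffun 'I_m -> bool}) \prod_i G i (e i)).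
    apply: eq_bigr => e _.
    have [/forallP h|/forallPn[j ej]] := boolP [forall j, e (f j)].
      rewrite [X in _ * X]big1 ?mulr1; last by move=> j _; rewrite h.
      apply: eq_bigr => i _; rewrite /G; case: ifP => // ei.
      suff -> : i \notin codom f by [].
      by apply/negP => /codomP[j ij]; rewrite ij h in ei.
    rewrite [X in _ * X](bigD1 j)//= (negbTE ej) mul0r mulr0.
    rewrite (bigD1 (f j))//= /G (negbTE ej) codom_f /= oppr0 mul0r.
    by [].
  rewrite -(bigA_distr_bigA G).
  under eq_bigr do rewrite big_bool /G.
  rewrite -codomE; have [/forallP h|/forallPn[i hi]] := boolP [forall i, i \in codom f].
    by rewrite big1// => i _; rewrite h /= oppr0 addr0.
  by rewrite (bigD1 i)//= hi subrr mul0r.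
under eq_bigr => f _.
  rewrite coefE.
  rewrite (_ : _ *: _ = (injectiveb f)%:R *: A x); last first.
    case: injectiveP => [fi|_]; last by rewrite !scale0r.
    rewrite !scale1r -[RHS](sA (perm fi)); congr A; apply/funext => i /=.
    by rewrite permE.
  over.
rewrite -scaler_suml -natr_sum; congr (_%:R *: _).
rewrite -(ffactnn m) -[in LHS](card_ord m) -card_inj_ffuns.
by rewrite -sum1_card [LHS]big_mkcond /=; apply: eq_bigr => f _; rewrite inE; case: injectiveb.
Qed.

(** Extrapolation from the nodes [0, ..., m] to the point [-1]: the Vandermonde matrix of distinct
    nodes is invertible. *)
Lemma interpolation_coef m : exists c : 'I_m.+1 -> R,
  forall d, (d <= m)%N -> \sum_k c k * k%:R ^+ d = (-1) ^+ d.
Proof.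
pose V : 'M[R]_m.+1 := Vandermonde m.+1 (\row_k k%:R).
have Vu : V \in unitmx.
  rewrite unitmxE unitfE det_Vandermonde.
  apply/prodf_neq0 => i _; apply/prodf_neq0 => j ij.
  by rewrite !mxE subr_eq0 eqr_nat neq_ltn ij orbT.
exists (fun k => (invmx V *m \col_d (-1) ^+ d) k ord0) => d dm.
have := mulKVmx Vu (\col_d (-1) ^+ d : 'cV[R]_m.+1).
move=> /matrixP/(_ (Ordinal (dm : (d < m.+1)%N)) ord0).
rewrite [LHS]mxE [RHS]mxE /= => <-; apply: eq_bigr => k _.
by rewrite mulrC !mxE.
Qed.

(** In [t], the value [P (a + t *: b)] is a polynomial of degree at most [m], the exponent counting
    the slots filled with [b]. The coefficients are chosen before the spaces and [P], so that
    estimates derived from them are uniform. *)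
Lemma poly_interpolation m : exists c : 'I_m.+1 -> R,
  forall (E F : lmodType R) (P : E -> F) (A : ('I_m -> E) -> F),
  assoc_symmetric_form P A ->
  forall a b, P (a - b) = \sum_k c k *: P (a + k%:R *: b).
Proof.
have [c hc] := interpolation_coef m; exists c => E F P A [lA _ PA] a b.
have PE (t : R) : P (a + t *: b) = \sum_(f : {ffun 'I_m -> bool})
    t ^+ #|[pred j | f j]| *: A (fun j => if f j then b else a).
  have := multilinear_expand (fun _ i => if i then t else 1)
    (fun _ (i : bool) => if i then b else a) lA.
  have -> : (fun _ : 'I_m => \sum_(i : bool) (if i then t else 1) *: (if i then b else a)) =
      (fun=> a + t *: b).
    by apply/funext => j; rewrite big_bool /= scale1r addrC.
  rewrite -PA => ->; apply: eq_bigr => f _; congr (_ *: _).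
  by rewrite -big_mkcond /= prodr_const.
under eq_bigr do rewrite PE scaler_sumr.
rewrite exchange_big /= -[in LHS](scaleN1r b) PE; apply: eq_bigr => f _.
under eq_bigr do rewrite scalerA.
by rewrite -scaler_suml hc// -[X in (_ <= X)%N]card_ord max_card.
Qed.

End Multilinear.

(** * Algebra and limits of associated symmetric forms *)

Section SymmetricForms.
Context {R : realType} (m : nat).

Lemma assoc_form0 (E F : lmodType R) :
  @assoc_symmetric_form R m E F 0 (fun=> 0).
Proof. by split=> // i x a s t /=; rewrite scaler0 addr0. Qed.

Lemma assoc_formD (E F : lmodType R) (P Q : E -> F) (A B : ('I_m -> E) -> F) :
  assoc_symmetric_form P A -> assoc_symmetric_form Q B ->
  assoc_symmetric_form (P + Q) (fun x => A x + B x).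
Proof.
move=> [lA sA PA] [lB sB QB]; split.
- by move=> i x a s t /=; rewrite lA lB scalerDr addrACA.
- by move=> s x; rewrite sA sB.
- by move=> x; rewrite -PA -QB.
Qed.

Lemma assoc_formZ (E F : lmodType R) (c : R) (P : E -> F) (A : ('I_m -> E) -> F) :
  assoc_symmetric_form P A -> assoc_symmetric_form (c *: P) (fun x => c *: A x).
Proof.
move=> [lA sA PA]; split.
- by move=> i x a s t /=; rewrite lA scalerDr !scalerA mulrC.
- by move=> s x; rewrite sA.
- by move=> x; rewrite -PA.
Qed.

Lemma dfwith_map (E G : lmodType R) (u : G -> E) (x : 'I_m -> G) i t :
  u \o @dfwith _ (fun=> G) x i t = @dfwith _ (fun=> E) (u \o x) i (u t).
Proof.
apply/funext => j /=; have [<-|ij] := eqVneq i j; first by rewrite !dfwithin.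
by rewrite !dfwithout.
Qed.

Lemma assoc_form_comp (E F G H : lmodType R) (P : E -> F) (A : ('I_m -> E) -> F)
    (u : {linear G -> E}) (v : {linear F -> H}) :
  assoc_symmetric_form P A ->
  assoc_symmetric_form (v \o P \o u) (fun x => v (A (u \o x))).
Proof.
move=> [lA sA PA]; split.
- by move=> i x a s t /=; rewrite !dfwith_map linearP lA linearP.
- by move=> s x; rewrite -[in RHS](sA s).
- by move=> x /=; rewrite PA.
Qed.

Lemma assoc_form_power (E F : lmodType R) (phi : {linear E -> R}) (y : F) :
  @assoc_symmetric_form R m E F (fun x => phi x ^+ m *: y)
    (fun x => (\prod_i phi (x i)) *: y).
Proof.
split.
- move=> i x a s t /=.
  have pE z : \prod_j phi (@dfwith _ (fun=> E) x i z j) =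
      phi z * \prod_(j | j != i) phi (x j).
    rewrite (bigD1 i)//= dfwithin; congr (_ * _); apply: eq_bigr => j ji.
    by rewrite dfwithout// eq_sym.
  rewrite !pE linearP mulrDl scalerDl; congr (_ + _).
  by rewrite -[a *: phi s]/(a * phi s) -mulrA scalerA.
- move=> s x /=; congr (_ *: _).
  by rewrite [RHS](reindex_inj (@perm_inj _ s)).
- by move=> x; rewrite prodr_const card_ord.
Qed.

(** Polarization expresses each form through values of [P_ k], so the forms converge pointwise to
    the same expression in [P]. Multilinearity and symmetry follow by uniqueness of limits. *)
Lemma assoc_form_lim (E : lmodType R) (F : normedModType R)
    (P_ : nat -> E -> F) (P : E -> F) :
  (forall k, exists A : ('I_m -> E) -> F, assoc_symmetric_form (P_ k) A) ->
  (forall x, P_ k x @[k --> \oo] --> P x) ->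
  exists A : ('I_m -> E) -> F, assoc_symmetric_form P A.
Proof.
move=> /choice[A_ PA_] PP.
pose A (x : 'I_m -> E) : F := m`!%:R^-1 *: \sum_(e : {ffun 'I_m -> bool})
  (\prod_i (if e i then 1 else -1)) *: P (\sum_i (e i)%:R *: x i).
have AA x : A_ k x @[k --> \oo] --> A x.
  have -> : A_ ^~ x = fun k => m`!%:R^-1 *: \sum_(e : {ffun 'I_m -> bool})
      (\prod_i (if e i then 1 else -1)) *: P_ k (\sum_i (e i)%:R *: x i).
    apply/funext => k; rewrite -(polarization x (PA_ k)) scalerA mulVf ?scale1r//.
  apply: cvgZl_tmp; apply: cvg_big => [|e _]; first exact: add_continuous.
  by apply: cvgZl_tmp; exact: PP.
have uniq (f : nat -> F) (a b : F) : f @ \oo --> a -> f @ \oo --> b -> a = b.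
  by move=> fa fb; apply: (@cvg_unique _ (@norm_hausdorff _ F) _ _ a b fa fb).
exists A; split.
- move=> i x a s t; apply: uniq (AA _) _.
  have -> : (fun k => A_ k (@dfwith _ (fun=> E) x i (a *: s + t))) =
    (fun k => a *: A_ k (@dfwith _ (fun=> E) x i s) + A_ k (@dfwith _ (fun=> E) x i t)).
    by apply/funext => k; have [lA _ _] := PA_ k; rewrite lA.
  by apply: cvgD; [apply: cvgZl_tmp|]; exact: AA.
- move=> s x; apply: uniq (AA _) _.
  have -> : (fun k => A_ k (x \o s)) = (fun k => A_ k x).
    by apply/funext => k; have [_ sA _] := PA_ k; rewrite sA.
  exact: AA.
- move=> x; apply: uniq (PP _) _.
  have -> : (fun k => P_ k x) = (fun k => A_ k (fun=> x)).
    by apply/funext => k; have [_ _ PA] := PA_ k; rewrite PA.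
  exact: AA.
Qed.

End SymmetricForms.

(** * Continuous homogeneous polynomials and the supremum norm *)

Section HomogeneousPolynomials.
Context {R : realType} (m : nat).
Implicit Types E F G H : normedModType R.

Lemma hpoly0 E F : hpoly m (0 : E -> F).
Proof.
by split; [move=> x; exact: cvg_cst|exists (fun=> 0); exact: assoc_form0].
Qed.

Lemma hpolyD E F (P Q : E -> F) : hpoly m P -> hpoly m Q -> hpoly m (P + Q).
Proof.
move=> [cP [A PA]] [cQ [B QB]]; split.
  by move=> x; apply: cvgD; [exact: cP|exact: cQ].
by exists (fun x => A x + B x); exact: assoc_formD.
Qed.

Lemma hpolyZ E F (c : R) (P : E -> F) : hpoly m P -> hpoly m (c *: P).
Proof.
move=> [cP [A PA]]; split; first by move=> x; apply: cvgZl_tmp; exact: cP.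
by exists (fun x => c *: A x); exact: assoc_formZ.
Qed.

Lemma hpoly_comp E F G H (P : E -> F) (u : {linear G -> E}) (v : {linear F -> H}) :
  continuous u -> continuous v -> hpoly m P -> hpoly m (v \o P \o u).
Proof.
move=> cu cv [cP [A PA]]; split; last by exists (fun x => v (A (u \o x))); exact: assoc_form_comp.
move=> x; apply: continuous_comp; first exact: cu.
by apply: continuous_comp; [exact: cP|exact: cv].
Qed.

Lemma hpoly_scaleE E F (P : E -> F) (t : R) x : hpoly m P -> P (t *: x) = t ^+ m *: P x.
Proof.
move=> [_ [A [lA _ PA]]]; rewrite !PA (multilinearZ (fun=> t))//.
by rewrite prodr_const card_ord.
Qed.

Hypothesis m0 : (0 < m)%N.

Lemma hpoly_at0 E F (P : E -> F) : hpoly m P -> P 0 = 0.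
Proof.
by move=> hP; rewrite -(scale0r 0) hpoly_scaleE// expr0n gtn_eqF// scale0r.
Qed.

(** Continuity at 0, where [P] vanishes because [m] is positive, gives [|P| < 1] on a ball of radius
    [d]. Scaling [x] to norm [d / 2] turns this into the constant [(d / 2)^-1 ^+ m]. *)
Lemma hpoly_bounded E F (P : E -> F) : hpoly m P ->
  exists2 M, 0 < M & forall x, `|P x| <= M * `|x| ^+ m.
Proof.
move=> hP; have P0 := hpoly_at0 hP.
have /cvgrPdist_lt/(_ _ ltr01) := hP.1 0; rewrite P0.
move=> /nbhs_norm0P [d /= d0 dP].
have d20 : 0 < d / 2 by rewrite divr_gt0.
exists ((d / 2)^-1 ^+ m); first by rewrite exprn_gt0// invr_gt0.
move=> x; have [->|x0] := eqVneq x 0.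
  by rewrite P0 !normr0 expr0n gtn_eqF// mulr0.
have nx : 0 < `|x| by rewrite normr_gt0.
pose t := d / 2 / `|x|; have t0 : 0 < t by rewrite divr_gt0.
have : `|P (t *: x)| < 1.
  have := dP (t *: x); rewrite /= sub0r normrN; apply.
  by rewrite normrZ gtr0_norm// divfK ?gt_eqF//; lra.
rewrite hpoly_scaleE// normrZ normrX (gtr0_norm t0) => /ltW.
rewrite -ler_pdivlMl ?exprn_gt0// mulr1 => /le_trans; apply.
by rewrite -exprVn -exprMn /t invf_div mulrC.
Qed.

Lemma supnorm_hpoly_ball E F (P : E -> F) x : hpoly m P -> `|x| <= 1 ->
  `|P x| <= supnorm P.
Proof.
move=> hP x1; apply: ub_le_sup; last by exists x.
have [M M0 PM] := hpoly_bounded hP; exists M => _ [y /= y1 <-].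
by apply: le_trans (PM y) _; rewrite ler_piMr ?(ltW M0)// exprn_ile1.
Qed.

Lemma supnorm_hpoly_ge0 E F (P : E -> F) : hpoly m P -> 0 <= supnorm P.
Proof.
by move=> hP; apply: le_trans (supnorm_hpoly_ball (x := 0) hP _); rewrite ?normr0.
Qed.

Lemma supnorm_hpoly E F (P : E -> F) x : hpoly m P ->
  `|P x| <= supnorm P * `|x| ^+ m.
Proof.
move=> hP; have [->|x0] := eqVneq x 0.
  by rewrite hpoly_at0// !normr0 expr0n gtn_eqF// mulr0.
have nx : 0 < `|x| by rewrite normr_gt0.
rewrite -ler_pdivrMr ?exprn_gt0// mulrC.
have -> : (`|x| ^+ m)^-1 * `|P x| = `|P (`|x|^-1 *: x)|.
  by rewrite hpoly_scaleE// normrZ normrX normfV normr_id exprVn.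
apply: supnorm_hpoly_ball => //.
by rewrite normrZ normfV normr_id mulVf// gt_eqF.
Qed.

Lemma supnorm_le_unit_ball E F (P : E -> F) M :
  (forall x, `|x| <= 1 -> `|P x| <= M) -> supnorm P <= M.
Proof.
move=> PM; apply: ge_sup; first by exists `|P 0|, 0; rewrite /= ?normr0.
by move=> _ [x /= x1 <-]; exact: PM.
Qed.

End HomogeneousPolynomials.

(** * Powers of functionals, and linear operators as polynomials *)

Lemma continuous_exprn {R : realType} (E : normedModType R) (f : E -> R) m :
  continuous f -> continuous (fun x => f x ^+ m).
Proof.
move=> cf x; elim: m => [|m IH]; first exact: cvg_cst.
rewrite (_ : (fun x => f x ^+ m.+1) = fun x => f x * f x ^+ m); last first.
  by apply/funext => z; rewrite exprS.
by apply: cvgM; [exact: cf|exact: IH].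
Qed.

Lemma hpoly_power {R : realType} m (E F : normedModType R) (phi : dual E) (y : F) :
  hpoly m (fun x => phi x ^+ m *: y).
Proof.
split; last by exists (fun x => (\prod_i phi (x i)) *: y); exact: assoc_form_power.
by move=> x; apply: cvgZr_tmp; apply: continuous_exprn; exact: dual_continuous.
Qed.

(** Makes the operator norm estimates the degree one case of those for polynomials. *)
Lemma hpoly_linear {R : realType} (E F : normedModType R) (u : {linear E -> F}) :
  continuous u -> hpoly 1 u.
Proof.
move=> cu; split=> //; exists (fun x => u (x ord0)); split=> //.
- move=> i x a s t /=; rewrite !ord1 !dfwithin; exact: linearP.
- by move=> s x; rewrite /= !ord1.
Qed.

Lemma supnorm_linear {R : realType} (E F : normedModType R) (u : {linear E -> F}) x :
  continuous u -> `|u x| <= supnorm u * `|x|.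
Proof. by move=> cu; have := supnorm_hpoly (ltn0Sn 0) x (hpoly_linear cu). Qed.

Lemma supnorm_linear_ge0 {R : realType} (E F : normedModType R) (u : {linear E -> F}) :
  continuous u -> 0 <= supnorm u.
Proof. by move=> cu; exact: (supnorm_hpoly_ge0 (ltn0Sn 0) (hpoly_linear cu)). Qed.

(** * Positive polynomials and the positive regular ball *)

Section PositivePolynomials.
Context {R : realType} (m : nat).
Implicit Types E F G H : banachLatticeType R.

Lemma pos_poly_hpoly E F (P : E -> F) : pos_poly m P -> hpoly m P.
Proof. by move=> [cP [A PA _]]; split=> //; exists A. Qed.

Lemma pos_poly_ge0 E F (P : E -> F) x : pos_poly m P -> 0 <=v x -> 0 <=v P x.
Proof. by move=> [_ [A [_ _ PA] A0]] x0; rewrite PA; exact: A0. Qed.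

Lemma pos_poly0 E F : pos_poly m (0 : E -> F).
Proof.
split; first by case: (hpoly0 m E F).
by exists (fun=> 0) => [|x _]; [exact: assoc_form0|exact: vle_refl].
Qed.

Lemma pos_polyD E F (P Q : E -> F) : pos_poly m P -> pos_poly m Q -> pos_poly m (P + Q).
Proof.
move=> pP pQ; split; first by case: (hpolyD (pos_poly_hpoly pP) (pos_poly_hpoly pQ)).
move: pP pQ => [_ [A PA A0]] [_ [B QB B0]].
exists (fun x => A x + B x); first exact: assoc_formD.
by move=> x x0; apply: vaddr_ge0; [exact: A0|exact: B0].
Qed.

Lemma pos_polyZ E F (c : R) (P : E -> F) : 0 <= c -> pos_poly m P -> pos_poly m (c *: P).
Proof.
move=> c0 pP; split; first by case: (hpolyZ c (pos_poly_hpoly pP)).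
move: pP => [_ [A PA A0]]; exists (fun x => c *: A x); first exact: assoc_formZ.
by move=> x x0; apply: vscale_ge0 => //; exact: A0.
Qed.

Lemma pos_poly_comp E F G (P : E -> F) (u : {linear G -> E}) : pos_operator u ->
  pos_poly m P -> pos_poly m (P \o u).
Proof.
move=> [cu u0] pP; have cid : continuous (idfun : F -> F) by move=> x; exact: cvg_id.
split; first by case: (hpoly_comp (v := idfun) cu cid (pos_poly_hpoly pP)).
move: pP => [_ [A PA A0]]; exists (fun x => A (u \o x)).
  exact: (assoc_form_comp u idfun PA).
by move=> x x0; apply: A0 => i; exact: u0.
Qed.

Lemma pos_poly_power E (phi : dual E) : 0 <=v phi -> pos_poly m (fun x => phi x ^+ m).
Proof.
move=> phi0; have pE : (fun x => phi x ^+ m) = (fun x => phi x ^+ m *: (1 : R)).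
  by apply/funext => x; rewrite -[RHS]/(_ * 1) mulr1.
split.
  by apply: continuous_exprn; exact: dual_continuous.
rewrite pE; exists (fun x => (\prod_i phi (x i)) *: (1 : R)).
  exact: assoc_form_power.
move=> x x0; rewrite -[_ *: _]/(_ * 1) mulr1; apply: prodr_ge0 => i _.
exact: phi0.
Qed.

(** Interpolation writes [P x] as a combination of values at [vpos x + k%:R *: vpos (- x)], all of
    which lie in the cone. *)
Lemma hpoly_cone_eq0 E (F : normedModType R) (P : E -> F) : hpoly m P ->
  (forall x, 0 <=v x -> P x = 0) -> P = 0.
Proof.
move=> [_ [A PA]] P0; apply/funext => x; rewrite (vposB x).
have [c /(_ _ _ _ _ PA) ->] := @poly_interpolation R m.
rewrite big1// => k _; rewrite P0 ?scaler0//.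
apply: vaddr_ge0; first exact: vpos_ge0.
by apply: vscale_ge0 => //; exact: vpos_ge0.
Qed.

Lemma pos_poly_modulus E (phi : E -> R) : pos_poly m phi -> is_poly_modulus m phi phi.
Proof.
move=> pphi; have p0 := @pos_poly0 E R; split.
- by exists phi, 0; split=> //; rewrite subr0.
- by rewrite /poly_le subrr.
- by rewrite /poly_le opprK; exact: pos_polyD.
- by [].
Qed.

(** Two moduli lie below each other, so their difference is nonnegative and nonpositive on the cone,
    and hence zero everywhere. *)
Lemma poly_modulus_pos E (phi : E -> R) : pos_poly m phi -> poly_modulus m phi = phi.
Proof.
move=> pphi; have mphi := pos_poly_modulus pphi.
have : is_poly_modulus m phi (poly_modulus m phi) by exact: getI mphi.
move: (poly_modulus m phi) => psi [_ phi_psi _ psi_min].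
case: mphi => rphi phi_phi Nphi_phi _; have psi_phi := psi_min _ rphi phi_phi Nphi_phi.
apply/eqP; rewrite -subr_eq0; apply/eqP; apply: hpoly_cone_eq0.
  exact: pos_poly_hpoly phi_psi.
move=> x x0; apply/eqP; rewrite eq_le; apply/andP; split; last exact: pos_poly_ge0 phi_psi x0.
have : 0 <= phi x - psi x by exact: pos_poly_ge0 psi_phi x0.
by rewrite -[(psi - phi) x]/(psi x - phi x); lra.
Qed.

(** Removes the modulus: on positive polynomials the regular norm is the supremum norm. *)
Lemma pos_regular_ballP E (phi : E -> R) :
  pos_regular_ball m phi <-> pos_poly m phi /\ supnorm phi <= 1.
Proof.
by split=> -[pphi]; rewrite /regular_norm ?poly_modulus_pos// => h; split=> //;
  rewrite /regular_norm poly_modulus_pos.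
Qed.

End PositivePolynomials.

(** * Duality *)

Section Duality.
Context {R : realType}.

Lemma dual_norm_le_bound (E : normedModType R) (f : dual E) (M : R) : 0 <= M ->
  (forall x, `|f x| <= M * `|x|) -> `|f| <= M.
Proof.
move=> M0 fM; apply: supnorm_le_ball => x x1; apply: le_trans (fM x) _.
by rewrite ler_piMr.
Qed.

Lemma bidual_eval_subproof (E : normedModType R) (z : E) :
  (fun f : dual E => f z) \in @linear_functional R _.
Proof.
apply: (dual_bounded_continuous (M := `|z|)) => [a f g //|f].
by rewrite mulrC; exact: dual_norm_le.
Qed.

(** The canonical embedding into the bidual. It preserves positivity, so evaluation at a positive
    vector can serve as a test functional in [weak_norm]. *)
Definition bidual_eval (E : normedModType R) (z : E) : dual (dual E) :=
  Dual (bidual_eval_subproof z).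

Lemma bidual_eval_norm (E : normedModType R) (z : E) : `|bidual_eval z| <= `|z|.
Proof.
by apply: dual_norm_le_bound => // f; rewrite mulrC; exact: (dual_norm_le f z).
Qed.

Lemma bidual_eval_ge0 (E : banachLatticeType R) (z : E) :
  0 <=v z -> 0 <=v bidual_eval z.
Proof. by move=> z0 f f0; exact: f0. Qed.

Lemma dual_le_vabs (E : banachLatticeType R) (f : dual E) x : 0 <=v x ->
  `|f x| <= vabs f x.
Proof.
move=> x0; rewrite ler_norml; apply/andP; split; last exact: (vjoin_l f (- f)).
by rewrite lerNl; exact: (vjoin_r f (- f)).
Qed.

Lemma dual_pos_vabs (E : banachLatticeType R) (f : dual E) z : 0 <=v f ->
  `|f z| <= f (vabs z).
Proof.
move=> f0; rewrite ler_norml; apply/andP; split; last first.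
  rewrite -subr_ge0 -linearB; apply: f0; apply/vsubr_ge0; exact: vjoin_l.
rewrite lerNl -linearN -subr_ge0 -linearB; apply: f0; apply/vsubr_ge0.
exact: vjoin_r.
Qed.

(** * Adjoints and biadjoints of continuous operators *)

Section Adjoint.
Variables (E F : normedModType R) (v : {linear E -> F}).
Hypothesis cv : continuous v.

Let adj_bound (f : dual F) x : `|f (v x)| <= `|f| * supnorm v * `|x|.
Proof.
apply: le_trans (dual_norm_le _ _) _; rewrite -mulrA ler_wpM2l//.
exact: supnorm_linear.
Qed.

Lemma adjoint_subproof (f : dual F) : f \o v \in @linear_functional R _.
Proof.
apply: (dual_bounded_continuous (M := `|f| * supnorm v)) => [a x y|x] /=.
  by rewrite !linearP.
exact: adj_bound.
Qed.

Definition adjoint (f : dual F) : dual E := Dual (adjoint_subproof f).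

Lemma adjoint_norm f : `|adjoint f| <= `|f| * supnorm v.
Proof.
apply: dual_norm_le_bound => [|x]; last exact: adj_bound.
by rewrite mulr_ge0// supnorm_linear_ge0.
Qed.

Let biadj_bound (xi : dual (dual E)) f : `|xi (adjoint f)| <= `|xi| * supnorm v * `|f|.
Proof.
apply: le_trans (dual_norm_le _ _) _; rewrite -mulrA ler_wpM2l//.
by rewrite mulrC; exact: adjoint_norm.
Qed.

Lemma biadjoint_subproof (xi : dual (dual E)) :
  xi \o adjoint \in @linear_functional R _.
Proof.
apply: (dual_bounded_continuous (M := `|xi| * supnorm v)) => [a f g|f] /=.
  by rewrite -linearP; congr (xi _); exact: dualP.
exact: biadj_bound.
Qed.

Definition biadjoint (xi : dual (dual E)) : dual (dual F) :=
  Dual (biadjoint_subproof xi).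

Lemma biadjoint_norm xi : `|biadjoint xi| <= `|xi| * supnorm v.
Proof.
apply: dual_norm_le_bound => [|f]; last exact: biadj_bound.
by rewrite mulr_ge0// supnorm_linear_ge0.
Qed.

End Adjoint.

Lemma adjoint_ge0 (E F : banachLatticeType R) (v : {linear E -> F})
    (pv : pos_operator v) (f : dual F) : 0 <=v f -> 0 <=v adjoint pv.1 f.
Proof. by move=> f0 x x0; apply: f0; exact: pv.2. Qed.

Lemma biadjoint_ge0 (E F : banachLatticeType R) (v : {linear E -> F})
    (pv : pos_operator v) (xi : dual (dual E)) : 0 <=v xi -> 0 <=v biadjoint pv.1 xi.
Proof. by move=> xi0 f f0; apply: xi0; exact: (adjoint_ge0 pv f0). Qed.

End Duality.

(** * Weak norms *)

Section WeakNorms.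
Context {R : realType}.

(** No boundedness is assumed: a set without supremum gets the default value 0. *)
Lemma sup_ge0 (S : set R) : (forall t, S t -> 0 <= t) -> 0 <= sup S.
Proof.
move=> S0; have [hS|hS] := pselect (has_sup S); last by rewrite sup_out.
by have [t St] := hS.1; apply: le_trans (S0 _ St) _; apply: (ub_le_sup hS.2).
Qed.

Lemma weak_norm_ge0 r (G : banachLatticeType R) n (y : 'I_n -> G) : 0 <= weak_norm r y.
Proof. by apply: sup_ge0 => _ [xi _ <-]; exact: lp_norm_ge0. Qed.

Lemma poly_weak_norm_ge0 q m (E : banachLatticeType R) n (x : 'I_n -> E) :
  0 <= poly_weak_norm q m x.
Proof. by apply: sup_ge0 => _ [phi _ <-]; exact: lp_norm_ge0. Qed.

Lemma weak_norm_leP r (G : banachLatticeType R) n (y : 'I_n -> G) M :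
  (forall xi : dual G, `|xi| <= 1 -> 0 <=v xi ->
    lp_norm r (fun i => xi (vabs (y i))) <= M) -> weak_norm r y <= M.
Proof.
move=> h; apply: ge_sup; last by move=> _ [xi [xi1 xi0] <-]; exact: h.
exists (lp_norm r (fun i => (0 : dual G) (vabs (y i)))); exists 0 => //.
by split; [rewrite normr0|exact: vle_refl].
Qed.

(** Normalising [xi] puts it into the unit ball, where the defining set is bounded by the lp norm of
    the [|y i|]. The zero functional cannot be normalised and is treated apart. *)
Lemma lp_norm_le_weak_norm r (G : banachLatticeType R) n (y : 'I_n -> G) (xi : dual G) :
  (1 <= r)%E -> 0 <=v xi ->
  lp_norm r (fun i => xi (vabs (y i))) <= `|xi| * weak_norm r y.
Proof.
move=> r1 xi0.
have bnd (z : dual G) : `|z| <= 1 -> 0 <=v z ->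
    lp_norm r (fun i => z (vabs (y i))) <= weak_norm r y.
  move=> z1 z0; apply: ub_le_sup; last by exists z.
  exists (lp_norm r (fun i => `|y i|)) => _ [w [w1 w0] <-].
  apply: ler_lp_norm => // i; rewrite normr_id -(vnorm_vabs (y i)).
  by apply: le_trans (dual_norm_le _ _) _; rewrite ler_piMl.
have [xi00|nxi] := eqVneq `|xi| 0.
  rewrite xi00 mul0r (_ : (fun i => _) = fun=> 0) ?lp_norm0//.
  by apply/funext => i; rewrite (normr0_eq0 xi00).
have pxi : 0 < `|xi| by rewrite lt_def nxi normr_ge0.
have := bnd (`|xi|^-1 *: xi); rewrite normrZ normfV normr_id mulVf// => /(_ (lexx _)).
have h : 0 <=v `|xi|^-1 *: xi by apply: vscale_ge0 => //; rewrite invr_ge0.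
move=> /(_ h); rewrite -[X in lp_norm _ X]/(fun i => `|xi|^-1 * xi (vabs (y i))).
by rewrite lp_normZ// normfV normr_id ler_pdivrMl.
Qed.

(** * Weak norms tested on positive polynomials *)

Section PolyWeakNorm.
Variables (q : \bar R) (m : nat).
Hypotheses (q1 : (1 <= q)%E) (m0 : (0 < m)%N).
Implicit Types E F G H : banachLatticeType R.

Lemma poly_weak_norm_leP E n (x : 'I_n -> E) M :
  (forall phi : E -> R, pos_poly m phi -> supnorm phi <= 1 ->
    lp_norm q (fun i => phi (x i)) <= M) -> poly_weak_norm q m x <= M.
Proof.
move=> h; apply: ge_sup; last by move=> _ [phi /pos_regular_ballP[pphi phi1] <-]; exact: h.
exists (lp_norm q (fun i => (0 : E -> R) (x i))); exists 0 => //.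
apply/pos_regular_ballP; split; first exact: pos_poly0.
by apply: supnorm_le_unit_ball => z _; rewrite normr0.
Qed.

Lemma supnorm_pos_polyZ E (c : R) (phi : E -> R) : pos_poly m phi ->
  supnorm (c *: phi) <= `|c| * supnorm phi.
Proof.
move=> pphi; apply: supnorm_le_unit_ball => z z1; rewrite normrM ler_wpM2l//.
exact: (supnorm_hpoly_ball m0 (pos_poly_hpoly pphi)).
Qed.

(** The same normalisation for polynomials: the supremum norm replaces the functional norm, and the
    powers [|x i| ^+ m] bound the defining set. *)
Lemma lp_norm_le_poly_weak_norm E n (x : 'I_n -> E) (phi : E -> R) :
  pos_poly m phi ->
  lp_norm q (fun i => phi (x i)) <= supnorm phi * poly_weak_norm q m x.
Proof.
move=> pphi.
have bnd (z : E -> R) : pos_poly m z -> supnorm z <= 1 ->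
    lp_norm q (fun i => z (x i)) <= poly_weak_norm q m x.
  move=> pz z1; apply: ub_le_sup; last by exists z => //; apply/pos_regular_ballP.
  exists (lp_norm q (fun i => `|x i| ^+ m)) => _ [w /pos_regular_ballP[pw w1] <-].
  apply: ler_lp_norm => // i; rewrite [leRHS]ger0_norm ?exprn_ge0//.
  apply: le_trans (supnorm_hpoly m0 (x i) (pos_poly_hpoly pw)) _.
  by rewrite ler_piMl ?exprn_ge0.
have s0 := supnorm_hpoly_ge0 m0 (pos_poly_hpoly pphi).
have [sphi|nphi] := eqVneq (supnorm phi) 0.
  rewrite sphi mul0r (_ : (fun i => _) = fun=> 0) ?lp_norm0//.
  apply/funext => i; apply/eqP; rewrite -normr_le0.
  by have := supnorm_hpoly m0 (x i) (pos_poly_hpoly pphi); rewrite sphi mul0r.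
have pphi0 : 0 < supnorm phi by rewrite lt_def nphi s0.
have := bnd ((supnorm phi)^-1 *: phi).
have h : 0 <= (supnorm phi)^-1 by rewrite invr_ge0.
move=> /(_ (pos_polyZ h pphi)) hb.
have /hb : supnorm ((supnorm phi)^-1 *: phi) <= 1.
  by apply: le_trans (supnorm_pos_polyZ _ pphi) _; rewrite ger0_norm// mulVf.
rewrite -[X in lp_norm _ X]/(fun i => (supnorm phi)^-1 * phi (x i)).
by rewrite lp_normZ// ger0_norm// ler_pdivrMl.
Qed.

(** For [phi] in the ball, [phi \o u] is a positive polynomial of supremum norm at most
    [supnorm u ^+ m]. *)
Lemma poly_weak_norm_comp E G (u : {linear G -> E}) n (x : 'I_n -> G) :
  pos_operator u ->
  poly_weak_norm q m (u \o x) <= supnorm u ^+ m * poly_weak_norm q m x.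
Proof.
move=> pu; apply: poly_weak_norm_leP => phi pphi phi1.
have pphiu := pos_poly_comp pu pphi.
apply: le_trans (lp_norm_le_poly_weak_norm x pphiu) _.
apply: ler_wpM2r; first exact: poly_weak_norm_ge0.
apply: supnorm_le_unit_ball => z z1.
apply: le_trans (supnorm_hpoly m0 (u z) (pos_poly_hpoly pphi)) _.
apply: le_trans (_ : `|u z| ^+ m <= _); first by rewrite ler_piMl ?exprn_ge0.
apply: lerXn2r; rewrite ?nnegrE ?supnorm_linear_ge0//; first exact: pu.1.
apply: le_trans (supnorm_linear z pu.1) _.
by rewrite ler_piMr// supnorm_linear_ge0//; exact: pu.1.
Qed.

End PolyWeakNorm.

(** Since the [y i] and their adjoint images are positive, their moduli disappear, and testing the
    images on [xi] means testing the [y i] on the biadjoint of [xi]. *)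
Lemma weak_norm_adjoint r (F H : banachLatticeType R) (v : {linear F -> H})
    (pv : pos_operator v) n (y : 'I_n -> dual H) :
  (1 <= r)%E -> (forall i, 0 <=v y i) ->
  weak_norm r (fun i => adjoint pv.1 (y i)) <= supnorm v * weak_norm r y.
Proof.
move=> r1 y0; apply: weak_norm_leP => xi xi1 xi0.
have -> : (fun i => xi (vabs (adjoint pv.1 (y i)))) =
    (fun i => biadjoint pv.1 xi (vabs (y i))).
  by apply/funext => i; rewrite !vabs_pos//; exact: adjoint_ge0.
apply: le_trans (lp_norm_le_weak_norm y r1 (biadjoint_ge0 pv xi0)) _.
apply: ler_wpM2r; first exact: weak_norm_ge0.
apply: le_trans (biadjoint_norm pv.1 xi) _.
by rewrite ler_piMl// supnorm_linear_ge0//; exact: pv.1.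
Qed.

End WeakNorms.

(** * Dominated polynomials *)

Section Dominated.
Context {R : realType}.
Variables (p q r : \bar R) (m : nat).
Hypotheses (p1 : (1 <= p)%E) (q1 : (1 <= q)%E) (r1 : (1 <= r)%E).
Hypothesis pqr : (p^-1 = q^-1 + r^-1)%E.
Hypothesis m0 : (0 < m)%N.
Implicit Types E F G H : banachLatticeType R.
Local Notation dom := (Defs.dominated_by p q r m).
Local Notation nrm := (dominated_norm p q r m).
Local Notation cls := (pos_weakly_dominated p q r m).

Let weak_prod_ge0 E F n (x : 'I_n -> E) (y : 'I_n -> dual F) :
  0 <= poly_weak_norm q m x * weak_norm r y.
Proof. by rewrite mulr_ge0 ?poly_weak_norm_ge0 ?weak_norm_ge0. Qed.

Lemma dominated_byW E F (P : E -> F) (C C' : R) : C <= C' -> dom P C -> dom P C'.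
Proof.
move=> CC' dP n x y x0 y0; apply: le_trans (dP n x y x0 y0) _.
by rewrite -!mulrA ler_wpM2r.
Qed.

Lemma dominated_norm_ge0 E F (P : E -> F) : 0 <= nrm P.
Proof.
rewrite /dominated_norm.
have [hS|hS] := pselect (has_inf [set C : R | 0 < C /\ dom P C]).
  by apply: lb_le_inf; [exact: hS.1|move=> C [/ltW]].
by rewrite inf_out.
Qed.

(** The infimum ranges over positive constants only; passing through [C + e] also admits [C = 0],
    which definiteness and limits require. *)
Lemma dominated_norm_le E F (P : E -> F) (C : R) : 0 <= C -> dom P C -> nrm P <= C.
Proof.
move=> C0 dP; apply/ler_addgt0Pr => e e0; apply: ge_inf.
  by exists 0 => D [/ltW].
by split; [rewrite ltr_wpDl|apply: dominated_byW dP; rewrite lerDl ltW].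
Qed.

(** The infimum is itself admissible. For fixed families one divides by the product [W] of the weak
    norms; if [W = 0], any admissible constant already makes the left side vanish. *)
Lemma dominated_by_norm E F (P : E -> F) : cls P -> dom P (nrm P).
Proof.
move=> [_ [C0 C00 dC0]] n x y x0 y0; rewrite -mulrA.
set W := poly_weak_norm _ _ _ * _; have : 0 <= W by exact: weak_prod_ge0.
rewrite le_eqVlt => /predU1P[W0|W0].
  by have := dC0 n x y x0 y0; rewrite -mulrA -/W -W0 !mulr0.
rewrite -ler_pdivrMr//; apply: lb_le_inf; first by exists C0.
by move=> C [_ dC]; rewrite ler_pdivrMr// mulrA; exact: dC.
Qed.

Lemma pos_weakly_dominatedI E F (P : E -> F) (C : R) : 0 <= C -> hpoly m P -> dom P C -> cls P.
Proof.
move=> C0 hP dP; split=> //; exists (C + 1); first by rewrite ltr_wpDl.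
by apply: dominated_byW dP; rewrite lerDl.
Qed.

(** * Stability of the defining inequality *)

Lemma dominated_by0 E F : dom (0 : E -> F) 0.
Proof.
move=> n x y x0 y0; rewrite !mul0r (_ : (fun i => _) = fun=> 0) ?lp_norm0//.
by apply/funext => i; exact: linear0.
Qed.

Lemma dominated_byD E F (P Q : E -> F) (C D : R) : dom P C -> dom Q D -> dom (P + Q) (C + D).
Proof.
move=> dP dQ n x y x0 y0; rewrite !mulrDl.
apply: le_trans (lerD (dP n x y x0 y0) (dQ n x y x0 y0)).
apply: le_trans (lp_normD _ _ p1); apply: ler_lp_norm => // i.
by rewrite -linearD.
Qed.

Lemma dominated_byZ E F (a : R) (P : E -> F) (C : R) : dom P C -> dom (a *: P) (`|a| * C).
Proof.
move=> dP n x y x0 y0; rewrite -!mulrA.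
have -> : (fun i => y i ((a *: P) (x i))) = (fun i => a * y i (P (x i))).
  by apply/funext => i; exact: linearZ.
by rewrite lp_normZ// ler_wpM2l// mulrA; exact: dP.
Qed.

(** Moving [v] to the other side of the pairing tests [P] on the positive families of the [u (x i)]
    and the adjoint images of the [y i]. *)
Lemma dominated_by_comp E F G H (P : E -> F) (u : {linear G -> E}) (v : {linear F -> H}) C :
  0 <= C -> pos_operator u -> pos_operator v -> dom P C ->
  dom (v \o P \o u) (supnorm v * C * supnorm u ^+ m).
Proof.
move=> C0 pu pv dP n x y x0 y0.
have ux0 i : 0 <=v (u \o x) i by exact: pu.2.
have yv0 i : 0 <=v adjoint pv.1 (y i) by exact: adjoint_ge0.
apply: le_trans (dP n (u \o x) (fun i => adjoint pv.1 (y i)) ux0 yv0) _.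
have -> : supnorm v * C * supnorm u ^+ m * poly_weak_norm q m x * weak_norm r y =
  C * (supnorm u ^+ m * poly_weak_norm q m x) * (supnorm v * weak_norm r y) by ring.
apply: ler_pM; rewrite ?mulr_ge0 ?poly_weak_norm_ge0 ?weak_norm_ge0//.
  by rewrite ler_wpM2l//; exact: poly_weak_norm_comp.
exact: weak_norm_adjoint.
Qed.

(** On positive arguments the pairing is at most [vabs phi x ^+ m * y (vabs z)]. The first factor is
    a positive polynomial in [x], the second a positive functional of [y], so Hoelder's inequality
    separates them into the two weak norms. *)
Lemma dominated_by_power E F (phi : dual E) (z : F) :
  dom (fun x => phi x ^+ m *: z) (`|phi| ^+ m * `|z|).
Proof.
move=> n x y x0 y0.
have pvphi := pos_poly_power m (vabs_ge0 phi).
have svphi : supnorm (fun x => vabs phi x ^+ m) <= `|phi| ^+ m.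
  apply: supnorm_le_unit_ball => t t1; rewrite normrX; apply: lerXn2r; rewrite ?nnegrE//.
  by apply: le_trans (dual_norm_le _ _) _; rewrite vnorm_vabs ler_piMr.
apply: le_trans (_ : lp_norm p (fun i =>
  vabs phi (x i) ^+ m * bidual_eval (vabs z) (vabs (y i))) <= _).
  apply: ler_lp_norm => // i; rewrite (vabs_pos (y0 i)) linearZ normrZ normrM.
  apply: ler_pM => //.
    rewrite !normrX; apply: lerXn2r; rewrite ?nnegrE//.
    by apply: le_trans (dual_le_vabs _ (x0 i)) _; exact: ler_norm.
  apply: le_trans (dual_pos_vabs _ (y0 i)) _; exact: ler_norm.
apply: le_trans (hoelder_lp_norm _ _ p1 q1 r1 pqr) _.
have -> : `|phi| ^+ m * `|z| * poly_weak_norm q m x * weak_norm r y =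
  (`|phi| ^+ m * poly_weak_norm q m x) * (`|z| * weak_norm r y) by ring.
apply: ler_pM; rewrite ?lp_norm_ge0//.
  apply: le_trans (lp_norm_le_poly_weak_norm q1 m0 x pvphi) _.
  by rewrite ler_wpM2r// poly_weak_norm_ge0.
apply: le_trans (lp_norm_le_weak_norm _ r1 (bidual_eval_ge0 (vabs_ge0 z))) _.
rewrite ler_wpM2r ?weak_norm_ge0//; apply: le_trans (bidual_eval_norm _) _.
by rewrite vnorm_vabs.
Qed.

(** * Supremum bounds and pointwise limits *)

Lemma dominated_single E F (P : E -> F) (C : R) x y : 0 <= C -> dom P C ->
  0 <=v x -> 0 <=v y -> `|(y : dual F) (P x)| <= C * `|x| ^+ m * `|y|.
Proof.
move=> C0 dP x0 y0; have := dP 1%N (fun=> x) (fun=> y) (fun=> x0) (fun=> y0).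
rewrite lp_norm1// => /le_trans; apply.
apply: ler_pM; rewrite ?mulr_ge0 ?weak_norm_ge0 ?poly_weak_norm_ge0//.
  rewrite ler_wpM2l//; apply: poly_weak_norm_leP => // phi pphi phi1; rewrite lp_norm1//.
  apply: le_trans (supnorm_hpoly m0 x (pos_poly_hpoly pphi)) _.
  by rewrite ler_piMl ?exprn_ge0.
apply: weak_norm_leP => xi xi1 xi0; rewrite lp_norm1//.
apply: le_trans (dual_norm_le _ _) _.
by rewrite vnorm_vabs ler_piMl.
Qed.

Lemma dominated_cone_bound E F (P : E -> F) (C : R) x : 0 <= C -> dom P C -> 0 <=v x ->
  `|P x| <= 2 * C * `|x| ^+ m.
Proof.
move=> C0 dP x0; have [f f1 fE] := norming_functional (P x).
have b (g : dual F) : `|g| <= 1 -> `|vpos g (P x)| <= C * `|x| ^+ m.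
  move=> g1; apply: le_trans (dominated_single C0 dP x0 (vpos_ge0 g)) _.
  rewrite ler_piMr ?mulr_ge0 ?exprn_ge0//.
  exact: le_trans (vpos_norm g) g1.
have {fE} : `|P x| = vpos f (P x) - vpos (- f) (P x).
  by rewrite -fE [in LHS](vposB f).
have := b f f1; have := b (- f); rewrite normrN => /(_ f1).
move=> /ler_normlP[? ?] /ler_normlP[? ?] ->.
by rewrite -mulrA; lra.
Qed.

(* The cone values determine a polynomial through interpolation along the
   lines [t |-> vpos x + t *: vpos (- x)]. *)
Lemma dominated_bound : exists2 K : R, 0 <= K &
  forall E F (P : E -> F) (C : R), 0 <= C -> hpoly m P -> dom P C ->
  forall x, `|P x| <= K * C * `|x| ^+ m.
Proof.
have [c hc] := @poly_interpolation R m.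
(* Each node contributes its coefficient, the factor 2 of the cone bound, and [(1 + k) ^+ m] because
   [vpos x + k%:R *: vpos (- x)] has norm at most [(1 + k) * |x|]. *)
exists (\sum_k `|c k| * (2 * (1 + k%:R) ^+ m)).
  by apply: sumr_ge0 => k _; rewrite !mulr_ge0// exprn_ge0// addr_ge0.
move=> E F P C C0 [_ [A PA]] dP x; rewrite {1}(vposB x) (hc _ _ _ _ PA).
apply: le_trans (ler_norm_sum _ _ _) _; rewrite !mulr_suml; apply: ler_sum => k _.
rewrite normrZ -!mulrA ler_wpM2l//.
have kx0 : 0 <=v vpos x + k%:R *: vpos (- x).
  by apply: vaddr_ge0; [|apply: vscale_ge0 => //]; exact: vpos_ge0.
apply: le_trans (dominated_cone_bound C0 dP kx0) _.
rewrite -mulrA ler_wpM2l// mulrCA ler_wpM2l// -exprMn.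
apply: lerXn2r; rewrite ?nnegrE ?mulr_ge0 ?addr_ge0//.
apply: le_trans (ler_normD _ _) _; rewrite mulrDl mul1r; apply: lerD; first exact: vpos_norm.
rewrite normrZ ger0_norm// ler_wpM2l//.
by apply: le_trans (vpos_norm _) _; rewrite normrN.
Qed.

(** A fixed finite family involves only finitely many convergent pairings, so one late [Q_ k]
    approximates them all at once and Minkowski's inequality absorbs the error. *)
Lemma dominated_by_lim E F (Q_ : nat -> E -> F) (Q : E -> F) (C : R) N :
  (forall x, Q_ k x @[k --> \oo] --> Q x) ->
  (forall k, (N <= k)%N -> dom (Q_ k) C) -> dom Q C.
Proof.
move=> QQ dQ n x y x0 y0; apply/ler_addgt0Pr => e e0.
(* A vector with entries at most [e / L] has lp norm at most [e]; the added 1 keeps [L] positive for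
   [n = 0]. *)
pose L := lp_norm p (fun _ : 'I_n => 1) + 1.
have L0 : 0 < L by rewrite ltr_wpDl// lp_norm_ge0.
have d0 : 0 < e / L by rewrite divr_gt0.
have : \forall k \near \oo, (N <= k)%N /\
    forall i, `|y i (Q (x i)) - y i (Q_ k (x i))| <= e / L.
  apply: filterI; first exact: nbhs_infty_ge.
  apply: (@filter_forall nat 'I_n
    (fun i k => `|y i (Q (x i)) - y i (Q_ k (x i))| <= e / L) (nbhs \oo) _) => i.
  have : y i (Q_ k (x i)) @[k --> \oo] --> y i (Q (x i)).
    exact: (cvg_comp (fun k => Q_ k (x i)) (y i) (QQ (x i)) (@dual_continuous _ _ _ _)).
  by move=> /cvgrPdist_le/(_ _ d0).
move=> /filter_ex[k [Nk hk]].
apply: le_trans (_ : lp_norm p (fun i => y i (Q_ k (x i))) +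
  lp_norm p (fun i => y i (Q (x i)) - y i (Q_ k (x i))) <= _).
  apply: le_trans (lp_normD _ _ p1); apply: ler_lp_norm => // i.
  by rewrite addrC subrK.
apply: lerD; first exact: dQ.
apply: le_trans (_ : lp_norm p (fun _ : 'I_n => (e / L) * 1) <= _).
  by apply: ler_lp_norm => // i; rewrite mulr1 (gtr0_norm d0).
rewrite lp_normZ// (gtr0_norm d0) mulrAC ler_pdivrMr// ler_wpM2l ?(ltW e0)//.
by rewrite lerDl.
Qed.

(** * The dominated polynomials as a normed space *)

Lemma pos_weakly_dominated0 E F : cls (0 : E -> F).
Proof.
by apply: (@pos_weakly_dominatedI _ _ _ 0) => //; [exact: hpoly0|exact: dominated_by0].
Qed.

Lemma pos_weakly_dominatedD E F (P Q : E -> F) : cls P -> cls Q -> cls (P + Q).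
Proof.
move=> cP cQ; apply: (@pos_weakly_dominatedI _ _ _ (nrm P + nrm Q)).
- by rewrite addr_ge0// dominated_norm_ge0.
- by apply: hpolyD; [exact: cP.1|exact: cQ.1].
- by apply: dominated_byD; exact: dominated_by_norm.
Qed.

Lemma pos_weakly_dominatedZ E F (a : R) (P : E -> F) : cls P -> cls (a *: P).
Proof.
move=> cP; apply: (@pos_weakly_dominatedI _ _ _ (`|a| * nrm P)).
- by rewrite mulr_ge0// dominated_norm_ge0.
- by apply: hpolyZ; exact: cP.1.
- by apply: dominated_byZ; exact: dominated_by_norm.
Qed.

Lemma pos_weakly_dominatedB E F (P Q : E -> F) : cls P -> cls Q -> cls (P - Q).
Proof.
move=> cP cQ; rewrite -scaleN1r; apply: pos_weakly_dominatedD => //.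
exact: pos_weakly_dominatedZ.
Qed.

Lemma dominated_normZ_le E F (a : R) (P : E -> F) : cls P -> nrm (a *: P) <= `|a| * nrm P.
Proof.
move=> cP; apply: dominated_norm_le; first by rewrite mulr_ge0// dominated_norm_ge0.
by apply: dominated_byZ; exact: dominated_by_norm.
Qed.

Lemma dominated_normZ E F (a : R) (P : E -> F) : cls P -> nrm (a *: P) = `|a| * nrm P.
Proof.
move=> cP; apply/eqP; rewrite eq_le dominated_normZ_le//=.
have [->|a0] := eqVneq a 0; first by rewrite normr0 mul0r dominated_norm_ge0.
have := dominated_normZ_le a^-1 (pos_weakly_dominatedZ a cP).
by rewrite scalerA mulVf// scale1r normfV ler_pdivlMl ?normr_gt0.
Qed.

Lemma pos_weakly_dominated_finite_type E F k (phi : 'I_k -> dual E) (y : 'I_k -> F) :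
  cls (fun x => \sum_(i < k) (phi i x ^+ m) *: y i).
Proof.
elim: k phi y => [|k IH] phi y.
  rewrite (_ : (fun x => _) = 0); first exact: pos_weakly_dominated0.
  by apply/funext => x; rewrite big_ord0.
rewrite (_ : (fun x => _) = (fun x => phi ord0 x ^+ m *: y ord0) +
    (fun x => \sum_(i < k) (phi (lift ord0 i) x ^+ m) *: y (lift ord0 i))).
  apply: pos_weakly_dominatedD; last exact: IH.
  apply: (pos_weakly_dominatedI _ (hpoly_power _ _ _) (@dominated_by_power _ _ _ _)).
  by rewrite mulr_ge0// exprn_ge0.
by apply/funext => x; rewrite big_ord_recl.
Qed.

(** The Cauchy condition gives pointwise Cauchy sequences by [dominated_bound]. Both the domination
    and the pointwise estimates for [P_ i - P_ j] survive the limit in [j], and yield membership of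
    the limit and convergence in norm. *)
Lemma dominated_complete E F (P_ : nat -> E -> F) : (forall k, cls (P_ k)) ->
  (forall e : R, 0 < e -> exists N : nat, forall i j : nat,
     (N <= i)%N -> (N <= j)%N -> nrm (P_ i - P_ j) < e) ->
  exists2 P : E -> F, cls P & nrm (P_ k - P) @[k --> \oo] --> (0 : R).
Proof.
move=> cP cauP; have [K K0 bnd] := dominated_bound.
have hcauchy e : 0 < e -> exists N, forall i j : nat, (N <= i)%N -> (N <= j)%N ->
    dom (P_ i - P_ j) e /\ forall x, `|P_ i x - P_ j x| <= K * e * `|x| ^+ m.
  move=> e0; have [N hN] := cauP e e0; exists N => i j Ni Nj.
  have cij := pos_weakly_dominatedB (cP i) (cP j).
  have dij : dom (P_ i - P_ j) e.
    by apply: dominated_byW (dominated_by_norm cij); exact/ltW/hN.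
  by split=> // x; exact: (bnd _ _ _ _ (ltW e0) cij.1 dij).
have cvx x : cvg (P_ k x @[k --> \oo]).
  apply/cauchy_cvgP/cauchy_exP => e e0.
  (* Chosen so that [K * d * |x| ^+ m < e]; the added 1 covers a vanishing [K] or [x]. *)
  pose d := e / (K * `|x| ^+ m + 1).
  have D0 : 0 < K * `|x| ^+ m + 1 by rewrite ltr_wpDl// mulr_ge0// exprn_ge0.
  have [N hN] := hcauchy d (divr_gt0 e0 D0); exists (P_ N x).
  exists N => // j /= Nj; rewrite -ball_normE /ball_ /=.
  apply: le_lt_trans ((hN N j (leqnn N) Nj).2 x) _.
  rewrite mulrAC /d mulrCA -[ltRHS]mulr1 ltr_pM2l// ltr_pdivrMr// mul1r.
  by rewrite ltrDl.
pose P x := lim (P_ k x @[k --> \oo]).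
have PP x : P_ k x @[k --> \oo] --> P x by exact: cvx.
(* The second index of the Cauchy estimates tends to infinity. *)
have hP e : 0 < e -> exists N, forall i, (N <= i)%N ->
    dom (P_ i - P) e /\ forall x, `|P_ i x - P x| <= K * e * `|x| ^+ m.
  move=> e0; have [N hN] := hcauchy e e0; exists N => i Ni.
  have PPi x : (P_ i - P_ k) x @[k --> \oo] --> (P_ i - P) x.
    by apply: cvgB; [exact: cvg_cst|exact: PP].
  split; first by apply: (dominated_by_lim (N := N) PPi) => k Nk; exact: (hN i k Ni Nk).1.
  move=> x; have /cvg_norm/cvgr_to_le := PPi x; apply.
  by exists N => // k /= Nk; exact: (hN i k Ni Nk).2.
(* A three-epsilon argument: [P_ N] is within [e / 3] of [P] on the ball of radius [|x| + 1] about
   0, which contains all points near [x]. *)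
have cntP : continuous P.
  move=> x; apply/cvgrPdist_le => e e0.
  pose M := K * (`|x| + 1) ^+ m.
  have M0 : 0 <= M by rewrite mulr_ge0// exprn_ge0// addr_ge0.
  have d0 : 0 < e / (3 * (M + 1)) by rewrite divr_gt0// mulr_gt0// ltr_wpDl.
  have [N hN] := hP _ d0; have {hN} [_ hN] := hN N (leqnn N).
  have e30 : 0 < e / 3 by rewrite divr_gt0.
  have hball z : `|z| <= `|x| + 1 -> `|P_ N z - P z| <= e / 3.
    move=> zx; apply: le_trans (hN z) _.
    apply: le_trans (_ : K * (e / (3 * (M + 1))) * (`|x| + 1) ^+ m <= _).
      apply: ler_wpM2l; first exact: mulr_ge0 K0 (ltW d0).
      by apply: lerXn2r; rewrite ?nnegrE ?addr_ge0.
    have -> : K * (e / (3 * (M + 1))) * (`|x| + 1) ^+ m = e / 3 * (M / (M + 1)).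
      by rewrite /M; field; rewrite gt_eqF// -/M ltr_wpDl.
    rewrite ler_piMr ?(ltW e30)// ler_pdivrMr ?mul1r ?lerDl//.
    by rewrite ltr_wpDl.
  have := (cP N).1.1 x; move=> /cvgrPdist_le/(_ _ e30) near1.
  have near2 : \forall z \near x, `|z| <= `|x| + 1.
    have : (fun z : E => z) @ x --> x by exact: cvg_id.
    move=> /cvgrPdist_lt/(_ _ ltr01); apply: filterS => z xz.
    have -> : z = x - (x - z) by rewrite subKr.
    by apply: le_trans (ler_normB _ _) _; rewrite lerD2l ltW.
  apply: filterS2 near1 near2 => z h1 h2.
  have -> : P x - P z = (P_ N z - P z) - (P_ N x - P x) + (P_ N x - P_ N z).
    by rewrite opprB -addrA subrKA addrC subrKA.
  apply: le_trans (ler_normD _ _) _.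
  have -> : e = e / 3 + e / 3 + e / 3 by lra.
  apply: lerD => //; apply: le_trans (ler_normB _ _) _; apply: lerD; first exact: hball.
  by apply: hball; rewrite lerDl.
have [A PA] : exists A : ('I_m -> E) -> F, assoc_symmetric_form P A.
  by apply: assoc_form_lim PP => k; exact: (cP k).1.2.
have hpP : hpoly m P by split=> //; exists A.
exists P; last first.
  apply/cvgrPdist_le => e e0; have [N hN] := hP e e0; exists N => // k /= Nk.
  rewrite sub0r normrN ger0_norm ?dominated_norm_ge0//.
  by apply: dominated_norm_le; [exact: ltW|exact: (hN k Nk).1].
(* Any fixed tolerance would do: [P] is [P_ N] minus a difference dominated with constant 1. *)
have [N hN] := hP 1 ltr01; have [d1 _] := hN N (leqnn N).
apply: (@pos_weakly_dominatedI _ _ _ (nrm (P_ N) + `|-1| * 1)) => //.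
  by rewrite addr_ge0 ?dominated_norm_ge0.
have -> : P = P_ N + (-1) *: (P_ N - P) by rewrite scaleN1r opprB addrC subrK.
by apply: dominated_byD; [exact: dominated_by_norm|exact: dominated_byZ].
Qed.

(** The upper bound is [dominated_by_power] for the identity functional [i] and the vector 1; the
    lower bound tests the one-term families [1] and [i]. *)
Lemma dominated_norm_power : nrm (fun x : R => x ^+ m) = 1.
Proof.
have idM (x : R) : `|x| <= 1 * `|x| by rewrite mul1r.
have idl : linear (fun x : R => x) by [].
pose i : dual R := Dual (dual_bounded_continuous idl idM).
have i1 : `|i| <= 1 by apply: dual_norm_le_bound.
have PE : (fun x : R => x ^+ m) = (fun x : R => i x ^+ m *: (1 : R)).
  by apply/funext => x; rewrite -[RHS]/(x ^+ m * 1) mulr1.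
have d1 : dom (fun x : R => x ^+ m) 1.
  rewrite PE; apply: dominated_byW (@dominated_by_power _ _ i (1 : R)).
  by rewrite normr1 mulr1 exprn_ile1.
apply/eqP; rewrite eq_le dominated_norm_le//=; apply: lb_le_inf; first by exists 1.
move=> C [C0 dC].
have i0 : 0 <=v i by move=> x.
have := @dominated_single _ _ _ _ (1 : R) i (ltW C0) dC ler01 i0.
rewrite /= normr1 !expr1n normr1 mulr1 => /le_trans; apply.
by rewrite ler_piMr// ltW.
Qed.

End Dominated.

(** * Verification of the ideal axioms *)

Theorem mainTheorem6 (R : realType) (p q r : \bar R)
    (hp : (1 <= p)%E) (hq : (1 <= q)%E) (hr : (1 <= r)%E)
    (hpqr : (p^-1 = q^-1 + r^-1)%E) :
  pos_banach_poly_ideal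
    (fun m E F => pos_weakly_dominated p q r m (E := E) (F := F))
    (fun m E F => dominated_norm p q r m (E := E) (F := F)).
Proof.
split.
- by move=> m E F _ P [].
- by move=> m E F m0; exact: pos_weakly_dominated0.
- by move=> m E F P Q m0; exact: pos_weakly_dominatedD.
- by move=> m E F a P m0; exact: pos_weakly_dominatedZ.
- by move=> m E F k phi y m0; exact: pos_weakly_dominated_finite_type.
- move=> m E F G H P u v m0 cP pu pv.
  have n0 := dominated_norm_ge0 p q r m P.
  apply: (pos_weakly_dominatedI _ _ (dominated_by_comp hq hr m0 n0 pu pv (dominated_by_norm cP))).
    by rewrite !mulr_ge0 ?exprn_ge0 ?supnorm_linear_ge0//; [exact: pv.1|exact: pu.1].
  by apply: hpoly_comp; [exact: pu.1|exact: pv.1|exact: cP.1].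
- by move=> m E F P _ _; exact: dominated_norm_ge0.
(* Vanishing of the norm means domination with constant 0, so the supremum bound reads
   [|P x| <= 0]. *)
- move=> m E F P m0 cP P0; have [K _ bnd] := dominated_bound hp hq hr m0.
  apply/funext => x; apply/eqP; rewrite -normr_le0.
  have := bnd _ _ _ _ (lexx 0) cP.1.
  by rewrite -{1}P0 => /(_ (dominated_by_norm cP) x); rewrite mulr0 mul0r.
- by move=> m E F a P m0; exact: dominated_normZ.
- move=> m E F P Q m0 cP cQ; apply: dominated_norm_le.
    by rewrite addr_ge0 ?dominated_norm_ge0.
  by apply: (dominated_byD hp); exact: dominated_by_norm.
- by move=> m E F P_ m0; exact: dominated_complete.
- by move=> m m0; exact: dominated_norm_power.
- move=> m E F G H P u v m0 cP pu pv; apply: dominated_norm_le.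
    rewrite !mulr_ge0 ?exprn_ge0 ?supnorm_linear_ge0 ?dominated_norm_ge0//.
      exact: pv.1.
    exact: pu.1.
  by apply: dominated_by_comp => //; [exact: dominated_norm_ge0|exact: dominated_by_norm].
Qed.
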